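(* It is decidable whether a finitely based avoidance set $\mathrm{Av}(B)$ of equivalence relations is atomic under the consecutive embedding ordering; that is, there is an algorithm which, given as input a finite set $B$ of equivalence relations on finite linearly ordered sets, decides whether $\mathrm{Av}(B)$ is atomic under the consecutive embedding ordering.
   Context: An equivalence relation here is a pair $(X,\rho)$ with $X$ a finite linearly ordered set (without loss of generality a finite subset of $\mathbb{N}$ with its natural order) and $\rho$ an equivalence relation on $X$. For $X=\{x_1<\dots<x_n\}$ and $Y=\{y_1<\dots<y_m\}$, a map $f:X\to Y$ is contiguous if there is $k$ with $f(x_i)=y_{k+i-1}$ for all $i\in\{1,\dots,n\}$. The consecutive embedding order: $(X,\rho)\le(Y,\sigma)$ iff there is a contiguous map $f:X\to Y$ such that $(x,y)\in\rho\Leftrightarrow(f(x),f(y))\in\sigma$ for all $x,y\in X$. Relations are isomorphic if such an $f$ exists which is a bijection; isomorphic relations are considered equal (so one may take the underlying set to be $[1,n]=\{1,\dots,n\}$), and this gives a poset. $\mathrm{Av}(B)$ is the set of equivalence relations $\sigma$ with $\rho\not\le\sigma$ for all $\rho\in B$. A downward closed set $C$ is atomic if it is not a union of two downward closed proper subsets of $C$; equivalently, for all $x,y\in C$ there is $z\in C$ with $x\le z$ and $y\le z$ (joint embedding property). *)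

(* Defs.v *)
From Stdlib Require List.
From mathcomp Require Import all_boot boolp classical_sets.

Set Implicit Arguments.
Unset Strict Implicit.
Unset Printing Implicit Defensive.

Local Open Scope classical_set_scope.

(** * Equivalence relations under the consecutive embedding order *)

(* Up to isomorphism the underlying linearly ordered set is [1, n]; it is
   represented by 'I_n = {0 < ... < n-1}. The empty relation (n = 0) is
   allowed. *)
Record erel := Erel {
  esize : nat;
  egraph : {set 'I_esize * 'I_esize};
  egraphP : equivalence_rel (fun x y => (x, y) \in egraph)
}.

(* With 0-based indices, f(x_i) = y_(k+i-1) becomes f i = k + i. *)
Definition contiguous n m (f : 'I_n -> 'I_m) : Prop :=
  exists k : nat, forall i : 'I_n, f i = k + i :> nat.

Definition cembeds (r s : erel) : Prop :=
  exists f : 'I_(esize r) -> 'I_(esize s),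
    contiguous f /\
    forall x y, (x, y) \in egraph r <-> (f x, f y) \in egraph s.

Definition Av (B : set erel) : set erel :=
  [set s | forall r, B r -> ~ cembeds r s].

Definition downclosed (C : set erel) : Prop :=
  forall r s, C s -> cembeds r s -> C r.

Lemma cembeds_trans r s t : cembeds r s -> cembeds s t -> cembeds r t.
Proof.
move=> [f [[k fk] fE]] [g [[l gl] gE]]; exists (g \o f); split.
  by exists (l + k) => i /=; rewrite gl fk addnA.
by move=> x y; rewrite fE gE.
Qed.

Lemma Av_downclosed B : downclosed (Av B).
Proof.
by move=> r s Cs rs b Bb br; apply: (Cs b Bb); exact: cembeds_trans br rs.
Qed.

(* [`<`] is strict inclusion of sets. *)
Definition atomic (C : set erel) : Prop :=
  downclosed C /\
  ~ exists A1 A2 : set erel,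
      [/\ downclosed A1, downclosed A2, A1 `<` C, A2 `<` C & C = A1 `|` A2].

(** * Algorithms: partial recursive functions *)

Inductive recfun : nat -> Type :=
| Zero n : recfun n
| Succ : recfun 1
| Proj n (i : 'I_n) : recfun n
| Comp m n (f : recfun m) (g : 'I_m -> recfun n) : recfun n
| PrimRec n (f : recfun n) (g : recfun n.+2) : recfun n.+1
| Mu n (f : recfun n.+1) : recfun n.

Section Graphs.
Variable n : nat.

Fixpoint primrec_graph (F : n.-tuple nat -> nat -> Prop)
    (G : n.+2.-tuple nat -> nat -> Prop)
    (k : nat) (v : n.-tuple nat) (y : nat) : Prop :=
  if k is k'.+1 then
    exists2 z, primrec_graph F G k' v z & G [tuple of k' :: z :: v] y
  else F v y.

(* y is the least root of F(-, v), and F(z, v) is defined for all z < y. *)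
Definition mu_graph (F : n.+1.-tuple nat -> nat -> Prop)
    (v : n.-tuple nat) (y : nat) : Prop :=
  F [tuple of y :: v] 0 /\
  forall z, z < y -> exists k, F [tuple of z :: v] k.+1.

End Graphs.

(* [eval p v y]: the computation of p on v halts with value y. *)
Fixpoint eval n (p : recfun n) : n.-tuple nat -> nat -> Prop :=
  match p in recfun n return n.-tuple nat -> nat -> Prop with
  | Zero _ => fun v y => y = 0
  | Succ => fun v y => y = (thead v).+1
  | Proj _ i => fun v y => y = tnth v i
  | Comp m _ f g => fun v y =>
      exists2 w : m.-tuple nat,
        forall i, eval (g i) v (tnth w i) & eval f w y
  | PrimRec _ f g => fun v y =>
      primrec_graph (eval f) (eval g) (thead v) [tuple of behead v] y
  | Mu _ f => mu_graph (eval f)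
  end.

Lemma eval_functional n (p : recfun n) v y1 y2 :
  eval p v y1 -> eval p v y2 -> y1 = y2.
Proof.
elim: p v y1 y2 => {n} /= [n||n i|m n f IHf g IHg|n f IHf g IHg|n f IHf] v y1 y2.
- by move=> -> ->.
- by move=> -> ->.
- by move=> -> ->.
- move=> [w1 g1 f1] [w2 g2 f2].
  have w12 : w1 = w2 by apply: eq_from_tnth => i; exact: IHg (g1 i) (g2 i).
  by rewrite w12 in f1; exact: IHf f1 f2.
- elim: (thead v) y1 y2 => [|k IHk] y1 y2 /=; first exact: IHf.
  move=> [z1 r1 s1] [z2 r2 s2]; rewrite (IHk _ _ r1 r2) in s1.
  exact: IHg s1 s2.
- move=> [z1 lt1] [z2 lt2]; case: (ltngtP y1 y2) => // lt12.
  + by have [k /(IHf _ _ _ z1)] := lt2 _ lt12.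
  + by have [k /(IHf _ _ _ z2)] := lt1 _ lt12.
Qed.

Definition recursively_decidable (T : Type) (enc : T -> nat)
    (P : T -> Prop) : Prop :=
  exists p : recfun 1, forall x,
    (P x -> eval p [tuple enc x] 1) /\ (~ P x -> eval p [tuple enc x] 0).

(** * Encoding of the inputs *)

(* [CodeSeq.code] is the explicit computable bijection from seq nat to nat
   given by [::] |-> 0 and n :: s |-> 2 ^ n * (2 * code s + 1). A relation is
   encoded by the code of the list of the codes of the rows of its 0/1
   incidence matrix. *)
Definition encode_erel (r : erel) : nat :=
  CodeSeq.code
    [seq CodeSeq.code
           [seq nat_of_bool ((x, y) \in egraph r) | y <- enum 'I_(esize r)]
    | x <- enum 'I_(esize r)].

Definition encode_erels (B : seq erel) : nat :=
  CodeSeq.code [seq encode_erel r | r <- B].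

Lemma encode_erel_inj : injective encode_erel.
Proof.
move=> [n1 A1 P1] [n2 A2 P2] /(can_inj CodeSeq.codeK) /= eqs.
have en : n1 = n2.
  by have /(congr1 size) := eqs; rewrite !size_map -!enumT !size_enum_ord.
subst n2; have eA : A1 = A2.
  apply/setP => -[x y].
  move/eq_in_map: eqs => /(_ x (mem_enum _ x)) /(can_inj CodeSeq.codeK).
  by move/eq_in_map => /(_ y (mem_enum _ y)); do 2 case: (_ \in _).
by subst A2; rewrite (Prop_irrelevance P1 P2).
Qed.

Lemma encode_erels_inj : injective encode_erels.
Proof.
by move=> B1 B2 /(can_inj CodeSeq.codeK) /(inj_map encode_erel_inj).
Qed.

Definition set_of_list (B : seq erel) : set erel :=
  [set r | List.In r B].

(* Main.v *)
Require Import Defs.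
From mathcomp Require Import all_boot.
From mathcomp Require Import boolp zify.

Set Implicit Arguments.
Unset Strict Implicit.
Unset Printing Implicit Defensive.

(* Av(B) is atomic iff any two of its members embed in a third one. Let w + 1
   bound the sizes in B, so that membership in Av(B) depends only on the
   windows of size w + 1; two members that share w consecutive positions can
   then be amalgamated freely, and a member with a repeated w-window can be
   shortened by cutting out the loop. Loop cutting bounds the size of a joint
   host of two given members. It remains to bound the pairs to be tested.

   Say that a window u reaches v if some member contains u and, not before it, v.
   If the last window of r reaches the first window of s, or conversely,
   amalgamation joins r and s. Otherwise, assuming that all small pairs can be
   joined, r and (an extension of) s both leave a set L of windows closed under
   predecessors for reachability; any member leaves L at most once, so a joint
   host must align the two exits. If r and s differ when so aligned, loop cutting
   yields a small pair with the same exit window that still differs, and such a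
   pair has no joint host. Hence r and s agree when aligned, and are joined by
   amalgamating them over their overlap.

   So atomicity amounts to a bounded search, with bounds computed from the code
   of B, which is then shown to be recursive. *)

(** * Relations on initial segments, windows and amalgamation *)

(* A relation on {0 < ... < n-1} is given by n and an equivalence relation on
   all of nat, of which only the part below n is relevant. *)
Definition nrel := nat -> nat -> Prop.

Record eqv (R : nrel) : Prop := Eqv {
  eqv_refl : forall i, R i i;
  eqv_sym : forall i j, R i j -> R j i;
  eqv_trans : forall j i k, R i j -> R j k -> R i k }.

Definition pull (f : nat -> nat) (R : nrel) : nrel := fun i j => R (f i) (f j).

Definition shift k (R : nrel) : nrel := pull (addn k) R.

Definition agree n (R S : nrel) : Prop :=
  forall i j, i < n -> j < n -> (R i j <-> S i j).

Lemma eqv_pull f R : eqv R -> eqv (pull f R).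
Proof.
move=> eR; split=> [i|i j|j i k]; rewrite /pull.
- exact: eqv_refl.
- exact: eqv_sym.
- exact: eqv_trans.
Qed.

Lemma shift0 R : shift 0 R = R.
Proof. by []. Qed.

Lemma shift_shift a b R : shift a (shift b R) = shift (b + a) R.
Proof. by apply/funext => i; apply/funext => j; rewrite /shift /pull !addnA. Qed.

Lemma agreeE n R S i j : agree n R S -> i < n -> j < n -> R i j = S i j.
Proof. by move=> RS ni nj; apply/propext; apply: RS. Qed.

Lemma agree_sym n R S : agree n R S -> agree n S R.
Proof. by move=> RS i j ni nj; rewrite RS. Qed.

Lemma agree_trans n R S T : agree n R S -> agree n S T -> agree n R T.
Proof. by move=> RS ST i j ni nj; rewrite RS // ST. Qed.

Lemma agree_shift n m k R S :
  agree n R S -> k + m <= n -> agree m (shift k R) (shift k S).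
Proof. by move=> RS kmn i j mi mj; apply: RS; lia. Qed.

Lemma agree_le n m R S : agree n R S -> m <= n -> agree m R S.
Proof. by move=> RS mn i j mi mj; apply: RS; lia. Qed.

(** * Gluing two equivalence relations along a common interval *)

Section Glue.
Variables (k m : nat) (R S : nrel).
Hypotheses (eR : eqv R) (eS : eqv S).
Hypothesis RS : forall i j, k <= i < m -> k <= j < m -> (R i j <-> S i j).

(** The transitive closure of [R] below [m] together with [S] from [k] on. As the two agree on the
    interval from [k] to [m], a single passage through it suffices to link the two sides. *)
Definition glue : nrel := fun i j =>
  [\/ [/\ i < m, j < m & R i j], [/\ k <= i, k <= j & S i j],
      [/\ i < m, k <= j & exists z, [/\ k <= z < m, R i z & S z j]]
    | [/\ k <= i, j < m & exists z, [/\ k <= z < m, S i z & R z j]]].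

Lemma glueL i j : i < m -> j < m -> (glue i j <-> R i j).
Proof.
move=> im jm; split=> [|?]; last by constructor 1.
case=> [[]//|[ki kj Sij]|[_ kj [z [zm Riz Szj]]]|[ki _ [z [zm Siz Rzj]]]].
- by apply/RS => //; lia.
- by apply: (eqv_trans eR Riz); apply/RS => //; lia.
- by apply: (eqv_trans eR _ Rzj); apply/RS => //; lia.
Qed.

Lemma glueR i j : k <= i -> k <= j -> (glue i j <-> S i j).
Proof.
move=> ki kj; split=> [|?]; last by constructor 2.
case=> [[im jm Rij]|[]//|[im _ [z [zm Riz Szj]]]|[_ jm [z [zm Siz Rzj]]]].
- by apply/RS => //; lia.
- by apply: (eqv_trans eS _ Szj); apply/RS => //; lia.
- by apply: (eqv_trans eS Siz); apply/RS => //; lia.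
Qed.

Lemma glue_free i j : i < k -> m <= j -> glue i j ->
  exists z, [/\ k <= z < m, R i z & S z j].
Proof. by move=> ik mj []; case; try lia. Qed.

Lemma glue_sym i j : glue i j -> glue j i.
Proof.
case=> [[im jm Rij]|[ki kj Sij]|[im kj [z [zm Riz Szj]]]|[ki jm [z [zm Siz Rzj]]]].
- by constructor 1; split=> //; apply: (eqv_sym eR).
- by constructor 2; split=> //; apply: (eqv_sym eS).
- by constructor 4; split=> //; exists z; split=> //; [apply: (eqv_sym eS)|apply: (eqv_sym eR)].
- by constructor 3; split=> //; exists z; split=> //; [apply: (eqv_sym eR)|apply: (eqv_sym eS)].
Qed.

Hypothesis km : k <= m.

(** For transitivity, a path that changes sides twice does so inside the overlap, where [R] and [S]
    coincide, so the detour can be carried out within one relation. *)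
Lemma eqv_glue : eqv glue.
Proof.
have tR := eqv_trans eR; have tS := eqv_trans eS.
split; [|exact: glue_sym|].
  move=> i; have [im|mi] := ltnP i m; first by constructor 1; split=> //; apply: eqv_refl.
  by constructor 2; split; [lia|lia|apply: eqv_refl].
move=> j i l.
case=> [[im jm Rij]|[ki kj Sij]|[im kj [z [zm Riz Szj]]]|[ki jm [z [zm Siz Rzj]]]].
- case=> [[_ lm Rjl]|[kj kl Sjl]|[_ kl [y [ym Rjy Syl]]]|[kj lm [y [ym Sjy Ryl]]]].
  + by constructor 1; split=> //; apply: tR Rjl.
  + by constructor 3; split=> //; exists j; split=> //; lia.
  + by constructor 3; split=> //; exists y; split=> //; apply: tR Rjy.
  + constructor 1; split=> //; apply: (tR _ _ _ Rij); apply: (tR _ _ _ _ Ryl).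
    by apply/RS => //; lia.
- case=> [[jm lm Rjl]|[_ kl Sjl]|[jm kl [y [ym Rjy Syl]]]|[_ lm [y [ym Sjy Ryl]]]].
  + by constructor 4; split=> //; exists j; split=> //; lia.
  + by constructor 2; split=> //; apply: tS Sjl.
  + constructor 2; split=> //; apply: (tS _ _ _ Sij); apply: (tS _ _ _ _ Syl).
    by apply/RS => //; lia.
  + by constructor 4; split=> //; exists y; split=> //; apply: tS Sjy.
- case=> [[jm lm Rjl]|[_ kl Sjl]|[jm kl [y [ym Rjy Syl]]]|[_ lm [y [ym Sjy Ryl]]]].
  + constructor 1; split=> //; apply: (tR _ _ _ Riz); apply: (tR _ _ _ _ Rjl).
    by apply/RS => //; lia.
  + by constructor 3; split=> //; exists z; split=> //; apply: tS Sjl.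
  + constructor 3; split=> //; exists y; split=> //; apply: (tR _ _ _ Riz).
    by apply: (tR _ _ _ _ Rjy); apply/RS => //; lia.
  + constructor 1; split=> //; apply: (tR _ _ _ Riz); apply: (tR _ _ _ _ Ryl).
    by apply/RS => //; apply: tS Sjy.
- case=> [[_ lm Rjl]|[kj kl Sjl]|[_ kl [y [ym Rjy Syl]]]|[kj lm [y [ym Sjy Ryl]]]].
  + by constructor 4; split=> //; exists z; split=> //; apply: tR Rjl.
  + constructor 2; split=> //; apply: (tS _ _ _ Siz); apply: (tS _ _ _ _ Sjl).
    by apply/RS => //; lia.
  + constructor 2; split=> //; apply: (tS _ _ _ Siz); apply: (tS _ _ _ _ Syl).
    by apply/RS => //; apply: tR Rjy.
  + constructor 4; split=> //; exists y; split=> //; apply: (tS _ _ _ Siz).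
    by apply: (tS _ _ _ _ Sjy); apply/RS => //; lia.
Qed.
End Glue.

(** * Repeated windows and local classes *)

Definition nwindows w := 2 ^ (w * w).

(** Pigeonhole: [nwindows w] counts all binary relations on [w] points, and one more starting
    position than that is available from [q] to [q + nwindows w]. *)
Lemma repeated_window w R q : exists a b,
  [/\ q <= a, a < b, b <= q + nwindows w & agree w (shift a R) (shift b R)].
Proof.
pose f (i : 'I_(nwindows w).+1) : {ffun 'I_w * 'I_w -> bool} :=
  [ffun x : 'I_w * 'I_w => `[< R (q + i + x.1) (q + i + x.2) >]].
have ninj : ~ injective f.
  move/leq_card; rewrite card_ord card_ffun card_bool card_prod card_ord.
  by rewrite ltnn.
have [i [j [ij fij]]] : exists i j : 'I_(nwindows w).+1, i < j /\ f i = f j.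
  apply: contrapT => no; apply: ninj => i j fij.
  by case: (ltngtP i j) => [lt|lt|/val_inj//]; case: no; [exists i, j|exists j, i].
exists (q + i), (q + j); split; [lia|lia|have := ltn_ord j; lia|].
move=> x y xw yw; have := congr1 (fun g : {ffun _} => g (Ordinal xw, Ordinal yw)) fij.
by rewrite !ffunE /= => /(congr1 is_true); rewrite !asboolE /shift /pull => ->.
Qed.

(** All that the combinatorics uses of the members of Av(B). With an abstract class in place of [B],
    the reversed class falls under the same lemmas. *)
Record local_class w (C : nat -> nrel -> Prop) : Prop := LocalClass {
  class_eqv : forall n R, C n R -> eqv R;
  class_factor : forall k m n R, C n R -> k + m <= n -> C m (shift k R);
  class_local : forall n R, eqv R -> w < n ->
    (forall k, k + w < n -> C w.+1 (shift k R)) -> C n R;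
  class_agree : forall n R S, eqv S -> agree n R S -> C n R -> C n S }.

(** * Amalgamation, loop cutting, and shrinking from the left *)

Section Left.
Variables (w : nat) (C : nat -> nrel -> Prop).
Hypothesis CP : local_class w C.

Lemma class_prefix m n R : C n R -> m <= n -> C m R.
Proof. by move=> CR mn; exact: (class_factor (k := 0) CP CR mn). Qed.

(** The overlap has at least [w] positions, so each window of size [w.+1] of the glued relation lies
    inside [R] or starts at [k] or later, inside [S]. The last clause, that no other links across
    arise, is what [shrink_left] exploits. *)
Lemma amalgamation k m n R S : C m R -> C n S -> k + w <= m -> m <= k + n ->
  agree (m - k) (shift k R) S ->
  exists T, [/\ C (k + n) T, agree m R T, agree n S (shift k T) &
    forall i j, i < k -> m <= j -> T i j ->
      exists z, [/\ k <= z < m, R i z & S (z - k) (j - k)]].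
Proof.
move=> CR CS kwm mkn RS.
have eR := class_eqv CP CR; have eS := class_eqv CP CS.
pose S' := pull (fun i => i - k) S.
have eS' : eqv S' by exact: eqv_pull.
have RS' i j : k <= i < m -> k <= j < m -> (R i j <-> S' i j).
  move=> im jm; rewrite /S' /pull -RS; [|lia|lia].
  by rewrite /shift /pull !subnKC //; lia.
pose T := glue k m R S'.
have km : k <= m by lia.
have eT : eqv T by exact: eqv_glue.
have RT : agree m R T by move=> i j im jm; apply: iff_sym; exact: glueL.
have ST : agree n S (shift k T).
  move=> i j im jm; apply: iff_sym; rewrite /shift /pull.
  by have := glueR eS' RS' (leq_addr i k) (leq_addr j k); rewrite /S' /pull !addKn.
exists T; split=> //; last first.
  move=> i j ik mj; exact: glue_free.
(* Locality speaks of more than [w] positions; otherwise the bounds force [k = 0] and [n = m]. *)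
have [lt|ge] := ltnP w (k + n); last first.
  have -> : k + n = m by lia.
  exact: class_agree CP _ _ _ eT RT CR.
apply: (class_local CP) => // q qlt.
have eq : eqv (shift q T) by exact: eqv_pull.
have [qm|mq] := leqP (q + w.+1) m.
  apply: (class_agree CP eq (agree_shift RT qm)); exact: class_factor CP _ _ _ _ CR qm.
have qE : q = k + (q - k) by lia.
rewrite qE -shift_shift.
apply: (class_agree CP _ (agree_shift (k := q - k) (m := w.+1) ST _)).
- by do 2 apply: eqv_pull.
- by lia.
- by apply: (class_factor CP CS); lia.
Qed.

(* T is R with the positions in [a, b) cut out. *)
Lemma cut_loop a b n R : C n R -> a < b -> b + w <= n ->
  agree w (shift a R) (shift b R) ->
  exists T, [/\ C (n - (b - a)) T, agree (a + w) R T,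
    agree (n - b) (shift b R) (shift a T) &
    forall i j, i < a -> a + w <= j -> T i j ->
      exists z, [/\ a <= z < a + w, R i z & R (z + (b - a)) (j + (b - a))]].
Proof.
move=> CR ab bwn ab_agree.
have C1 : C (a + w) R by apply: (class_prefix CR); lia.
have C2 : C (n - b) (shift b R) by apply: (class_factor CP CR); lia.
have [|||T [CT RT ST freeT]] := amalgamation (k := a) C1 C2 _ _ _.
- by [].
- by lia.
- by rewrite addKn.
exists T; split=> //; first by have -> : n - (b - a) = a + (n - b) by lia.
move=> i j ia aj Tij; have [z [az Riz Szj]] := freeT i j ia aj Tij.
exists z; split=> //; move: Szj; rewrite /shift /pull.
have -> : b + (z - a) = z + (b - a) by lia.
by have -> : b + (j - a) = j + (b - a) by lia.
Qed.

Let K := nwindows w.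
(* Both loops cut in shrink_left lie within the first margin positions. *)
Definition margin := K + K + w + w + 2.

(* Position 0, isolated within its window, is made related to the far position y;
   windows of size w + 1 do not see the change. *)
Lemma relink T y n : C n T -> w < y < n ->
  (forall j, 0 < j <= w -> ~ T 0 j) -> (forall j, 0 < j <= w -> ~ T y j) ->
  exists S, [/\ C n S, S 0 y & forall k m, 0 < k -> agree m (shift k T) (shift k S)].
Proof.
move=> CT /andP[wy yn] T0 Ty; have eT := class_eqv CP CT.
(* Pulling back along a map that sends 0 to [y] puts 0 into the class of [y] and preserves the
   equivalence laws. *)
pose f i := if i == 0 then y else i.
pose S := pull f T.
have eS : eqv S by exact: eqv_pull.
have ST k m : 0 < k -> agree m (shift k T) (shift k S).
  by case: k => // k _ i j _ _.
exists S; split=> //; last first.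
  by rewrite /S /pull /f /= gtn_eqF ?(leq_ltn_trans _ wy) //; apply: eqv_refl.
apply: (class_local CP) => // [|k kn]; first by lia.
have eq : eqv (shift k S) by exact: eqv_pull.
have CkT : C w.+1 (shift k T) by apply: (class_factor CP CT); lia.
apply: (class_agree CP eq _ CkT).
(* Only the window at 0 contains position 0, and there 0 is isolated before the change by [T0] and
   after it by [Ty]. *)
case: k {kn eq CkT} => [|k]; last exact: ST.
move=> i j iw jw; rewrite !shift0 /S /pull /f.
case: i iw => [|i] iw; case: j jw => [|j] jw //=.
- by split=> _; apply: eqv_refl.
- by split=> [/T0|/Ty]; case; lia.
- by split=> [/(eqv_sym eT)/T0|/(eqv_sym eT)/Ty]; case; lia.
Qed.

(* If R and S differ beyond position 0, drop it. Otherwise let y be least with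
   R 0 y and S 0 y different, say R 0 y. If y is small, cut the same loop beyond y
   from both. If y is large, cut a loop before y from R and compare the result with
   its variant in which 0 is linked to the new position of y. *)
Lemma shrink_left n p R S : C n R -> C n S -> margin <= p <= n -> ~ agree n R S ->
  exists d R' S', [/\ 0 < d <= p, C (n - d) R' /\ C (n - d) S', ~ agree (n - d) R' S',
    agree (n - p) (shift p R) (shift (p - d) R') &
    agree (n - p) (shift p S) (shift (p - d) S')].
Proof.
move=> CR CS /andP[mp pn] nRS; rewrite /margin in mp.
have eR := class_eqv CP CR; have eS := class_eqv CP CS.
have [RS|nRS'] := pselect (agree n.-1 (shift 1 R) (shift 1 S)); last first.
  exists 1, (shift 1 R), (shift 1 S); split; rewrite ?subn1 ?shift_shift //; first by lia.
  - by split; [apply: (class_factor CP CR)|apply: (class_factor CP CS)]; lia.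
  - by have -> : 1 + p.-1 = p by lia.
  - by have -> : 1 + p.-1 = p by lia.
have {}RS i j : 0 < i < n -> 0 < j < n -> (R i j <-> S i j).
  case: i j => // i [|j] //= ni nj; by apply: (RS i j); lia.
have [y yP ymin] : exists2 y, y < n /\ ~ (R 0 y <-> S 0 y) &
    forall z, z < y -> (R 0 z <-> S 0 z).
  have ex : exists y, `[< y < n /\ ~ (R 0 y <-> S 0 y) >].
    apply: contrapT => no; apply: nRS.
    have no0 z : z < n -> (R 0 z <-> S 0 z).
      by move=> zn; apply: contrapT => h; apply: no; exists z; apply/asboolP.
    move=> [|i] [|j] ni nj; [exact: no0|exact: no0| |exact: RS].
    split=> [/(eqv_sym eR)/no0 h|/(eqv_sym eS)/no0 h].
      by apply: (eqv_sym eS); apply: h.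
    by apply: (eqv_sym eR); apply: h.
  exists (ex_minn ex); first by case: ex_minnP => y /asboolP.
  case: ex_minnP => y /asboolP[yn _] ymin z zy; apply: contrapT => h.
  suff /ymin : `[< z < n /\ ~ (R 0 z <-> S 0 z) >] by lia.
  by apply/asboolP; split=> //; lia.
have y0 : 0 < y by case: y yP {ymin} => [[_ []]|//]; split=> _; apply: eqv_refl.
wlog Ry : R S CR CS eR eS RS nRS yP ymin / R 0 y /\ ~ S 0 y.
  move=> th; have [Ry|nRy] := pselect (R 0 y).
    apply: th => //; split=> // Sy; by case: yP => _ [].
  have Sy : S 0 y by apply: contrapT => nSy; case: yP => _ [].
  have [|||||d [R' [S' [d0 [CR' CS'] nRS' sR sS]]]] := th S R CS CR eS eR.
  - by move=> i j ni nj; rewrite RS.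
  - by move=> /(@agree_sym n S R).
  - by case: yP => yn h; split=> // -[h1 h2]; apply: h.
  - by move=> z zy; rewrite ymin.
  - by [].
  by exists d, S', R'; split=> // /(@agree_sym _ S' R').
case: yP => yn _; case: Ry => Ry nSy.
(* Otherwise [S 0 z] by minimality of [y], and [S z y] because [R] and [S] agree beyond 0, against
   [~ S 0 y]. *)
have R0 z : 0 < z < y -> ~ R 0 z.
  move=> zy Rz; apply: nSy; apply: (eqv_trans eS (j := z)).
    by apply/ymin => //; lia.
  apply/RS; [lia|lia|]; exact: (eqv_trans eR (eqv_sym eR Rz)).
(* A small [y] lies before every loop found from [K + w + 2] on, and such a loop of [R] is also one
   of [S], since the two agree beyond 0. *)
have [ylt|yge] := ltnP y (K + w + 2).
  have [a [b [qa ab bq Rab]]] := repeated_window w R (K + w + 2); rewrite -/K in bq.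
  have Sab : agree w (shift a S) (shift b S).
    move=> i j iw jw; rewrite /shift /pull -!RS; [exact: Rab|lia..].
  have [|R' [CR' RR' sR _]] := cut_loop CR ab _ Rab; first by lia.
  have [|S' [CS' SS' sS _]] := cut_loop CS ab _ Sab; first by lia.
  exists (b - a), R', S'; split; first by lia.
  - by [].
  - move=> RS'; apply: nSy.
    by rewrite (agreeE SS') -?(agreeE RS') -?(agreeE RR') //; lia.
  - have -> : shift p R = shift (p - b) (shift b R) by rewrite shift_shift subnKC //; lia.
    have -> : shift (p - (b - a)) R' = shift (p - b) (shift a R').
      by rewrite shift_shift (_ : a + (p - b) = p - (b - a)) //; lia.
    by apply: (agree_shift sR); lia.
  - have -> : shift p S = shift (p - b) (shift b S) by rewrite shift_shift subnKC //; lia.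
    have -> : shift (p - (b - a)) S' = shift (p - b) (shift a S').
      by rewrite shift_shift (_ : a + (p - b) = p - (b - a)) //; lia.
    by apply: (agree_shift sS); lia.
(* For large [y], the loop and the window following it end before [y]. The cut relation [T] does not
   link 0 to [y - d], as no position of [R] strictly between 0 and [y] is related to 0. So [T]
   replaces [R], and its relinked variant replaces [S], which agrees with [R] beyond 0. *)
have [a [b [qa ab bq Rab]]] := repeated_window w R 1; rewrite -/K in bq.
have [|T [CT RT sT freeT]] := cut_loop CR ab _ Rab; first by lia.
pose d := b - a; rewrite -/d in CT freeT.
have [|||S' [CS' Sy' sS']] := @relink T (y - d) (n - d) CT.
- by lia.
- move=> j jw; rewrite -RT; [|lia|lia]; by apply: R0; lia.
(* Either way, such a link comes from a position of [R] strictly between 0 and [y] in the class of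
   [y], which [R0] excludes. *)
- move=> j jw Tj; have [ja|ja] := ltnP j a.
    have [|z [zr Rjz Rzy]] := freeT j (y - d) ja _ (eqv_sym (class_eqv CP CT) Tj).
      by lia.
    have yE : y - d + d = y by lia.
    rewrite yE in Rzy; apply: (R0 (z + d)); first by lia.
    exact: (eqv_trans eR Ry (eqv_sym eR Rzy)).
  apply: (R0 (j + d)); first by lia.
  apply: (eqv_trans eR Ry).
  have := sT (y - b) (j - a); rewrite /shift /pull.
  have -> : b + (y - b) = y by lia.
  have -> : b + (j - a) = j + d by lia.
  have -> : a + (y - b) = y - d by lia.
  have -> : a + (j - a) = j by lia.
  by move=> -> //; lia.
have sR : agree (n - p) (shift p R) (shift (p - d) T).
  have -> : shift p R = shift (p - b) (shift b R) by rewrite shift_shift subnKC //; lia.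
  have -> : shift (p - d) T = shift (p - b) (shift a T).
    by rewrite shift_shift (_ : a + (p - b) = p - (b - a)) //; lia.
  by apply: (agree_shift sT); lia.
exists d, T, S'; split=> //; first by lia.
- move=> TS'; have T0 : T 0 (y - d) by rewrite (agreeE TS') //; lia.
  have [||z [zr Rz _]] := freeT 0 (y - d) _ _ T0; [lia|lia|].
  by apply: (R0 z) => //; lia.
- apply: agree_trans (sS' _ (n - p) _); last by lia.
  apply: agree_trans sR; move=> i j ip jp; rewrite /shift /pull; apply: iff_sym.
  by apply: RS; lia.
Qed.

End Left.

(** * Reduction to small pairs *)

Definition mirror n (R : nrel) : nrel := pull (fun i => n.-1 - i) R.

Lemma mirrorK n R : agree n (mirror n (mirror n R)) R.
Proof.
move=> i j ni nj; rewrite /mirror /pull.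
have e x : x < n -> n.-1 - (n.-1 - x) = x by lia.
by rewrite !e.
Qed.

Lemma agree_mirror n R S : agree n R S -> agree n (mirror n R) (mirror n S).
Proof. by move=> RS i j ni nj; apply: RS; lia. Qed.

Lemma mirror_shift k m n R : k + m <= n ->
  agree m (mirror m (shift k R)) (shift (n - (k + m)) (mirror n R)).
Proof.
move=> kmn i j im jm; rewrite /mirror /shift /pull.
have e x : x < m -> n.-1 - (n - (k + m) + x) = k + (m.-1 - x) by lia.
by rewrite !e.
Qed.

(** [eqv R] is a separate condition because [mirror n R] sees only finitely many positions of [R],
    whereas [class_eqv] concerns all of them. *)
Definition mirror_class (C : nat -> nrel -> Prop) n R := eqv R /\ C n (mirror n R).

Lemma mirror_class_local w C : local_class w C -> local_class w (mirror_class C).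
Proof.
move=> CP; split.
- by move=> n R [].
- move=> k m n R [eR CR] kmn; have eS : eqv (shift k R) by exact: eqv_pull.
  split=> //.
  have CRk : C m (shift (n - (k + m)) (mirror n R)).
    by apply: (class_factor CP CR); lia.
  by apply: (class_agree CP _ (agree_sym (mirror_shift _ kmn)) CRk); exact: eqv_pull.
- move=> n R eR wn loc; split=> //; apply: (class_local CP) => //.
    exact: eqv_pull.
  move=> k kwn; have [|_ CRk] := loc (n - (k + w.+1)); first by lia.
  apply: (class_agree CP _ _ CRk); first by do 2 apply: eqv_pull.
  have := @mirror_shift (n - (k + w.+1)) w.+1 n R.
  by rewrite (_ : n - (n - (k + w.+1) + w.+1) = k); [apply|]; lia.
- move=> n R S eS RS [_ CR]; split=> //.
  by apply: (class_agree CP _ (agree_mirror RS) CR); exact: eqv_pull.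
Qed.

Section Shrink.
Variables (w : nat) (C : nat -> nrel -> Prop).
Hypothesis CP : local_class w C.

(** This is [shrink_left] for the mirror images with [p := n - q]: the suffix preserved there is the
    prefix of length [q] here. *)
Lemma shrink_right n q R S : C n R -> C n S -> q + margin w <= n -> ~ agree n R S ->
  exists m R' S', [/\ q <= m < n, C m R' /\ C m S', ~ agree m R' S',
    agree q R R' & agree q S S'].
Proof.
move=> CR CS qn nRS; have CP' := mirror_class_local CP.
have mir T : C n T -> mirror_class C n (mirror n T).
  move=> CT; have eT := class_eqv CP CT; split; first exact: eqv_pull.
  have eM : eqv (mirror n (mirror n T)) by do 2 apply: eqv_pull.
  exact: (class_agree CP eM (agree_sym (mirrorK T)) CT).
have [||d [R1 [S1 [d0 [[_ CR1] [_ CS1]] nRS1 sR sS]]]] :=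
    shrink_left CP' (mir R CR) (mir S CS) (p := n - q) _ _.
- by lia.
- move=> h0; have h := agree_mirror h0; apply: nRS.
  exact: agree_trans (agree_trans (agree_sym (mirrorK R)) h) (mirrorK S).
have pre T T1 :
    agree (n - (n - q)) (shift (n - q) (mirror n T)) (shift (n - q - d) T1) ->
    agree q T (mirror (n - d) T1).
  move=> h i j iq jq; have := h (q.-1 - i) (q.-1 - j).
  rewrite /mirror /shift /pull.
  have e x : x < q -> n.-1 - (n - q + (q.-1 - x)) = x by lia.
  have f x : x < q -> n - q - d + (q.-1 - x) = (n - d).-1 - x by lia.
  by rewrite !e // !f //; apply; lia.
exists (n - d), (mirror (n - d) R1), (mirror (n - d) S1); split.
- by lia.
- by [].
- move=> h0; have h := agree_mirror h0; apply: nRS1.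
  exact: agree_trans (agree_trans (agree_sym (mirrorK R1)) h) (mirrorK S1).
- exact: pre sR.
- exact: pre sS.
Qed.

(** In a longer relation, any window of size [w.+1] has a full margin on its left or on its
    right. *)
Definition core_bound := margin w + margin w + w.+1.

(** Induction on [n]: cuts are made on a side of the window at [p] with a full margin, so the window
    survives, moving left when the cut is before it. *)
Lemma shrink n p R S : C n R -> C n S -> p + w < n -> ~ agree n R S ->
  exists m q R' S', [/\ m <= core_bound /\ q + w < m, C m R' /\ C m S',
    ~ agree m R' S', agree w.+1 (shift p R) (shift q R') &
    agree w.+1 (shift p S) (shift q S')].
Proof.
elim/ltn_ind: n p R S => n IHn p R S CR CS pn nRS.
have [small|large] := leqP n core_bound.
  by exists n, p, R, S.
rewrite /core_bound in large.
have [mp|pm] := leqP (margin w) p.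
  have mpn : margin w <= p <= n by lia.
  have [d [R1 [S1 [d0 [CR1 CS1] nRS1 sR sS]]]] := shrink_left CP CR CS mpn nRS.
  have [||m [q [R' [S' [mq C' n' sR' sS']]]]] := IHn _ _ (p - d) _ _ CR1 CS1 _ nRS1.
  - by lia.
  - by lia.
  exists m, q, R', S'; split=> //.
    by apply: agree_trans sR'; apply: agree_le sR _; lia.
  by apply: agree_trans sS'; apply: agree_le sS _; lia.
have [|m1 [R1 [S1 [d0 [CR1 CS1] nRS1 sR sS]]]] :=
  @shrink_right _ (p + w.+1) _ _ CR CS _ nRS; first by lia.
have [||m [q [R' [S' [mq C' n' sR' sS']]]]] := IHn _ _ p _ _ CR1 CS1 _ nRS1.
- by lia.
- by lia.
exists m, q, R', S'; split=> //.
  exact: agree_trans (agree_shift sR (leqnn _)) sR'.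
exact: agree_trans (agree_shift sS (leqnn _)) sS'.
Qed.

End Shrink.

(** * Joint hosts and their size *)

Definition occurs m R t T := exists i, i + m <= t /\ agree m R (shift i T).

Lemma occurs_trans m R n S t T : occurs m R n S -> occurs n S t T -> occurs m R t T.
Proof.
move=> [i [imn RS]] [j [jnt ST]]; exists (j + i); split; first by lia.
by rewrite -shift_shift; apply: agree_trans RS (agree_shift ST imn).
Qed.

Section Joint.
Variables (w : nat) (C : nat -> nrel -> Prop).
Hypothesis CP : local_class w C.

Definition joint m R n S :=
  exists t T, [/\ C t T, occurs m R t T & occurs n S t T].

Lemma joint_sym m R n S : joint m R n S -> joint n S m R.
Proof. by case=> t [T [CT RT ST]]; exists t, T. Qed.

Lemma joint_occurs m R n S m' R' n' S' : occurs m R m' R' -> occurs n S n' S' ->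
  joint m' R' n' S' -> joint m R n S.
Proof.
move=> RR SS [t [T [CT RT ST]]]; exists t, T.
by split=> //; [apply: occurs_trans RR RT|apply: occurs_trans SS ST].
Qed.

Definition joint_bound m n := m + n + (nwindows w + w).

(** A gap of more than [nwindows w + w] positions between the two copies contains a repeated window,
    and cutting that loop damages neither copy. *)
Lemma joint_bounded m R n S : joint m R n S ->
  exists t T, [/\ t <= joint_bound m n, C t T, occurs m R t T & occurs n S t T].
Proof.
suff H m0 R0 n0 S0 t T j : C t T -> m0 <= t -> agree m0 R0 T -> j + n0 <= t ->
    agree n0 S0 (shift j T) ->
    exists t T, [/\ t <= joint_bound m0 n0, C t T, occurs m0 R0 t T & occurs n0 S0 t T].
  case=> t [T [CT [i [imt RT]] [j [jnt ST]]]].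
  have [ij|/ltnW ij] := leqP i j.
    have CT' : C (t - i) (shift i T) by apply: (class_factor CP CT); lia.
    apply: (H _ _ _ _ _ _ (j - i) CT') => //; [lia|lia|].
    by rewrite shift_shift subnKC.
  have CT' : C (t - j) (shift j T) by apply: (class_factor CP CT); lia.
  have [||||t' [T' [t'b CT'' ST' RT']]] := H n S m R _ _ (i - j) CT'.
  - by lia.
  - by [].
  - by lia.
  - by rewrite shift_shift subnKC.
  by exists t', T'; split=> //; move: t'b; rewrite /joint_bound (addnC n).
elim/ltn_ind: t T j => t IHt T j CT mt RT jt ST.
have [jm|mj] := leqP j (m0 + (nwindows w + w)).
  exists (maxn m0 (j + n0)), T; split.
  - by rewrite /joint_bound; lia.
  - by apply: (class_prefix CP CT); lia.
  - by exists 0; split; [lia|].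
  - by exists j; split; [lia|].
have [a [b [ma ab bm Tab]]] := repeated_window w T m0.
have [|T' [CT' TT' sT _]] := cut_loop CP CT ab _ Tab; first by lia.
apply: (IHt _ _ T' (j - (b - a)) CT').
- by lia.
- by lia.
- by apply: agree_trans RT _; apply: agree_le TT' _; lia.
- by lia.
- apply: agree_trans ST _.
  have -> : shift j T = shift (j - b) (shift b T) by rewrite shift_shift subnKC //; lia.
  have -> : shift (j - (b - a)) T' = shift (j - b) (shift a T').
    by rewrite shift_shift (_ : a + (j - b) = j - (b - a)) //; lia.
  by apply: (agree_shift sT); lia.
Qed.

(** * Reachability between windows *)

Definition reach (U V : nrel) := exists t T i j,
  [/\ C t T, i <= j, j + w <= t, agree w U (shift i T) & agree w V (shift j T)].

Lemma reach_in t T i j : C t T -> i <= j -> j + w <= t -> reach (shift i T) (shift j T).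
Proof. by move=> CT ij jt; exists t, T, i, j. Qed.

Lemma reach_agree U V : C w V -> agree w U V -> reach U V /\ reach V U.
Proof. by move=> CV UV; split; exists w, V, 0, 0; split. Qed.

(** Two amalgamations over [w] positions: a member leading from the last window of [R] to the first
    of [S] is appended to [R], and [S] to the result. *)
Lemma reach_join m R n S : C m R -> C n S -> w <= m -> w <= n ->
  reach (shift (m - w) R) S ->
  exists t T, [/\ C t T, m <= t /\ n <= t, agree m R T & agree n S (shift (t - n) T)].
Proof.
move=> CR CS wm wn [t0 [T0 [i [j [CT0 ij jt Ri Sj]]]]].
have CV : C (j - i + w) (shift i T0) by apply: (class_factor CP CT0); lia.
have [|||T1 [CT1 RT1 VT1 _]] := amalgamation (k := m - w) CP CR CV _ _ _.
- by lia.
- by lia.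
- by rewrite subKn.
rewrite (_ : m - w + (j - i + w) = m + (j - i)) in CT1; last by lia.
have [|||T [CT T1T ST _]] := amalgamation (k := m + (j - i) - w) CP CT1 CS _ _ _.
- by lia.
- by lia.
- rewrite subKn; last by lia.
  apply: agree_trans (agree_sym Sj).
  rewrite (_ : m + (j - i) - w = m - w + (j - i)); last by lia.
  rewrite -shift_shift; apply: agree_sym.
  have -> : shift j T0 = shift (j - i) (shift i T0) by rewrite shift_shift subnKC.
  exact: agree_shift VT1 _.
exists (m + (j - i) - w + n), T; split=> //.
- by lia.
- by apply: agree_trans RT1 (agree_le T1T _); lia.
- by rewrite addnK.
Qed.

Lemma reach_trans V U X : reach U V -> reach V X -> reach U X.
Proof.
move=> [t [T [i [j [CT ij jt Ui Vj]]]]] [t' [T' [i' [j' [CT' ij' jt' Vi Xj]]]]].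
have C1 : C (j + w) T by apply: (class_prefix CP CT).
have C2 : C (j' - i' + w) (shift i' T') by apply: (class_factor CP CT'); lia.
have [|||Y [CY TY SY _]] := amalgamation (k := j) CP C1 C2 _ _ _.
- by [].
- by lia.
- by rewrite addKn; apply: agree_trans (agree_sym Vj) Vi.
exists (j + (j' - i' + w)), Y, i, (j + (j' - i')); split=> //.
- by lia.
- by lia.
- by apply: agree_trans Ui _; apply: (agree_shift TY); lia.
- apply: agree_trans Xj _; rewrite -shift_shift.
  have -> : shift j' T' = shift (j' - i') (shift i' T') by rewrite shift_shift subnKC.
  by apply: (agree_shift SY); lia.
Qed.

(** * Leaving a set of windows closed under predecessors *)

Section Crossing.
Variable L : nrel -> Prop.
Hypothesis L_reach : forall U V, reach U V -> L V -> L U.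

(** The two windows together cover [w.+1] positions, the size that [shrink] preserves. *)
Definition crosses n R p := [/\ p + w < n, L (shift p R) & ~ L (shift p.+1 R)].

Lemma crosses_exists n R : C n R -> w <= n -> L R -> ~ L (shift (n - w) R) ->
  exists p, crosses n R p.
Proof.
move=> CR wn LR nLR.
have ex : exists q, `[< ~ L (shift q R) >] by exists (n - w); apply/asboolP.
case: (ex_minnP ex) => -[/asboolP|q /asboolP nLq qmin]; first by rewrite shift0.
have qn : q < n - w by apply: qmin; apply/asboolP.
exists q; split=> //; first by lia.
apply: contrapT => nL; suff : q < q by rewrite ltnn.
by apply: qmin; apply/asboolP.
Qed.

(** After leaving [L] a member never returns: a later window in [L] would force the earlier ones
    into [L]. *)
Lemma crosses_unique n R p q : C n R -> crosses n R p -> crosses n R q -> p = q.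
Proof.
move=> CR [pn Lp nLp] [qn Lq nLq].
have later a b : a < b -> b + w < n -> L (shift b R) -> L (shift a.+1 R).
  by move=> ab bn; apply: L_reach; apply: (reach_in CR) => //; lia.
case: (ltngtP p q) => // lt; [case: nLp|case: nLq]; exact: later lt _ _.
Qed.

Lemma crosses_agree n R p n' R' p' : C n' R' -> p' + w < n' ->
  agree w.+1 (shift p R) (shift p' R') -> crosses n R p -> crosses n' R' p'.
Proof.
move=> CR pn' RR [pn Lp nLp].
have C0 : C w (shift p' R') by apply: (class_factor CP CR); lia.
have C1 : C w (shift p'.+1 R') by apply: (class_factor CP CR); lia.
have RR1 : agree w (shift p.+1 R) (shift p'.+1 R').
  by rewrite -[p.+1]addn1 -[p'.+1]addn1 -!shift_shift; apply: agree_shift RR _; lia.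
have [_ r0] := reach_agree C0 (agree_le RR (leqnSn w)).
have [r1 _] := reach_agree C1 RR1.
split=> //; first exact: L_reach r0 Lp.
by move=> /(L_reach r1).
Qed.

Variable N : nat.
Hypothesis N_large : core_bound w <= N.
Hypothesis small : forall m n R S, m <= N -> n <= N -> C m R -> C n S -> joint m R n S.

(** A difference would survive in a small pair whose members still cross at a common position [q]. A
    joint host of that pair crosses only once, so the two copies start at the same place in it and
    therefore agree. *)
Lemma crosses_eq n R S p : C n R -> C n S -> crosses n R p -> crosses n S p -> agree n R S.
Proof.
move=> CR CS cR cS; apply: contrapT => nRS; have [pn _ _] := cR.
have [m [q [R' [S' [[mN qm] [CR' CS'] nRS' RR SS]]]]] := shrink CP CR CS pn nRS.
have mN' : m <= N by lia.
have [t [T [CT [i [imt RT]] [j [jmt ST]]]]] := small mN' mN' CR' CS'.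
have cT k U : k + m <= t -> C m U -> agree m U (shift k T) -> crosses m U q ->
    crosses t T (k + q).
  move=> kt CU UT; apply: crosses_agree => //; first by lia.
  by rewrite -shift_shift; apply: (agree_shift UT); lia.
have cTi := cT _ _ imt CR' RT (crosses_agree CR' qm RR cR).
have cTj := cT _ _ jmt CS' ST (crosses_agree CS' qm SS cS).
have ij : i = j by have := crosses_unique CT cTi cTj; lia.
by apply: nRS'; rewrite -ij in ST; apply: agree_trans RT (agree_sym ST).
Qed.

Lemma crosses_joint m R p n S q : C m R -> C n S -> crosses m R p -> crosses n S q ->
  joint m R n S.
Proof.
wlog qp : m R p n S q / q <= p.
  move=> th CR CS cR cS; have [qp|/ltnW pq] := leqP q p; first exact: th qp CR CS cR cS.
  by apply: joint_sym; apply: th pq CS CR cS cR.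
move=> CR CS cR cS; have [pm Lp nLp] := cR; have [qn Lq nLq] := cS.
(* With the crossings aligned, [S] starts at position [p - q] of [R], and [q + l] is the length of
   the common part. *)
pose l := minn (m - p) (n - q).
have C1 : C (q + l) (shift (p - q) R) by apply: (class_factor CP CR); lia.
have C2 : C (q + l) S by apply: (class_prefix CP CS); lia.
have RS : agree (q + l) (shift (p - q) R) S.
  apply: (crosses_eq (p := q)) => //.
    split; first by lia.
      by rewrite shift_shift subnK.
    by rewrite shift_shift addnS subnK.
  by split=> //; lia.
(* Either [S] ends within [R], which is then the host, or it sticks out and is amalgamated. *)
have [lt|ge] := leqP (n - q) (m - p).
  exists m, R; split=> //; first by exists 0; split.
  exists (p - q); split; first by lia.
  by apply: agree_sym; apply: agree_le RS _; lia.
have [|||T [CT RT ST _]] := amalgamation (k := p - q) CP CR CS _ _ _.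
- by lia.
- by lia.
- by apply: agree_le RS _; lia.
exists (p - q + n), T; split=> //.
  by exists 0; split=> //; lia.
by exists (p - q).
Qed.

End Crossing.

(** * From small pairs to all pairs *)

Variable N : nat.
Hypothesis N_large : core_bound w <= N.
Hypothesis small : forall m n R S, m <= N -> n <= N -> C m R -> C n S -> joint m R n S.

Lemma reach_total U V : C w U -> C w V -> reach U V \/ reach V U.
Proof.
have wN : w <= N by apply: leq_trans N_large; rewrite /core_bound; lia.
move=> CU CV; have [t [T [CT [i [it UT]] [j [jt VT]]]]] := small wN wN CU CV.
have [ij|/ltnW ij] := leqP i j; [left|right].
  by exists t, T, i, j.
by exists t, T, j, i.
Qed.

Lemma windows_joint m R n S : w <= m -> w <= n -> C m R -> C n S -> joint m R n S.
Proof.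
wlog RS : m R n S / reach R S.
  move=> th wm wn CR CS; case: (reach_total (class_prefix CP CR wm) (class_prefix CP CS wn)).
    by move=> RS; exact: th.
  by move=> SR; apply: joint_sym; exact: th.
move=> wm wn CR CS; apply: contrapT => nJ.
pose b := shift (m - w) R; pose d := shift (n - w) S.
have Cb : C w b by apply: (class_factor CP CR); lia.
have Cd : C w d by apply: (class_factor CP CS); lia.
have nbS : ~ reach b S.
  move=> /(reach_join CR CS wm wn)[t [T [CT [mt nt] RT ST]]]; apply: nJ.
  exists t, T; split=> //; first by exists 0.
  by exists (t - n); split=> //; lia.
(* The first windows of [R] and [S] lie in [L], the last window [b] of [R] does not. So [R] crosses,
   and a crossing of [S] or of an extension of [S] is wanted. *)
pose L U := reach U S.
have L_reach U V : reach U V -> L V -> L U by exact: reach_trans.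
have Sd : reach S d by apply: (reach_in (i := 0) CS); lia.
have SS : reach S S by apply: (reach_in (i := 0) (j := 0) CS); lia.
have cR : exists p, crosses L m R p by exact: crosses_exists.
have [p cRp] := cR.
(* If the last window of [S] reaches back to the first, it also reaches [b], as reachability is
   total; an extension of [S] that ends with [b] then crosses. *)
have [dS|ndS] := pselect (reach d S); last first.
  have [q cSq] : exists q, crosses L n S q by exact: crosses_exists.
  exact: nJ (crosses_joint L_reach N_large small CR CS cRp cSq).
have Sb : reach S b by case: (reach_total Cb (class_prefix CP CS wn)).
have db := reach_trans dS Sb.
have [t [T [CT [nt wt] ST bT]]] := reach_join CS Cb wn (leqnn w) db.
have CT' : C w (shift (t - w) T) by apply: (class_factor CP CT); lia.
have [q cTq] : exists q, crosses L t T q.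
  apply: crosses_exists => //.
    have [_ TS] := reach_agree (class_prefix CP CT (leq_trans wn nt)) (agree_le ST wn).
    exact: L_reach TS SS.
  move=> LT; apply: nbS; have [bT' _] := reach_agree CT' bT.
  exact: L_reach bT' LT.
apply: nJ; apply: (joint_occurs (m' := m) (R' := R) (n' := t) (S' := T)).
- by exists 0; split.
- by exists 0; split.
exact: (crosses_joint L_reach N_large small CR CT cRp cTq).
Qed.

Lemma small_joint m R n S : C m R -> C n S -> joint m R n S.
Proof.
have wN : w <= N by apply: leq_trans N_large; rewrite /core_bound; lia.
move=> CR CS; have [/andP[mN nN]|big] := boolP ((m <= N) && (n <= N)); first exact: small.
(* One of the two members has size at least [N >= w] and supplies [U]; joining with [U] extends a
   member shorter than [w]. *)
have [U CU] : exists U, C w U.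
  have [Nm|mN] := leqP N m; [exists R|exists S].
    by apply: (class_prefix CP CR); lia.
  by apply: (class_prefix CP CS); lia.
have extend k T : C k T -> exists k' T', [/\ w <= k', C k' T' & occurs k T k' T'].
  move=> CT; have [wk|/ltnW kw] := leqP w k.
    by exists k, T; split=> //; exists 0; split.
  have [t [T' [CT' TT' [i [it _]]]]] := small (leq_trans kw wN) wN CT CU.
  by exists t, T'; split=> //; lia.
have [m' [R' [wm CR' RR]]] := extend _ _ CR.
have [n' [S' [wn CS' SS]]] := extend _ _ CS.
by apply: joint_occurs RR SS _; exact: windows_joint.
Qed.

End Joint.

(** * Recursive functions *)

(* [F v] is the value at the argument list v, read as an environment of de
   Bruijn variables: under a bounded quantifier or sum, the bound variable is
   [nth 0 v 0] and the outer environment is [drop 1 v]. *)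
Definition computable k (F : seq nat -> nat) : Prop :=
  exists p : recfun k, forall v : k.-tuple nat, eval p v (F v).

Lemma computable_ext k F G : (forall v, size v = k -> F v = G v) ->
  computable k F -> computable k G.
Proof.
by move=> FG [p pF]; exists p => v; rewrite -FG ?size_tuple //; apply: pF.
Qed.

Lemma computable_var i k F : i < k -> (forall v, F v = nth 0 v i) -> computable k F.
Proof.
move=> ik FE; exists (Proj (Ordinal ik)) => v /=.
by rewrite FE (tnth_nth 0).
Qed.

Lemma computable_subst k Gs F : computable (size Gs) F ->
  (forall i, i < size Gs -> computable k (nth (fun=> 0) Gs i)) ->
  computable k (fun v => F [seq G v | G : seq nat -> nat <- Gs]).
Proof.
move=> [p pF] cG.
have /choice[g gG] (i : 'I_(size Gs)) : exists q : recfun k, forall v : k.-tuple nat,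
    eval q v (nth (fun=> 0) Gs i v) by exact: cG.
exists (Comp p g) => v /=.
have sz : size [seq G (tval v) | G : seq nat -> nat <- Gs] == size Gs by rewrite size_map.
exists (Tuple sz); last exact: pF.
move=> i; rewrite (tnth_nth 0) (nth_map (fun=> 0)) //; exact: gG.
Qed.

Lemma computable1 k f F : computable 1 (fun v => f (nth 0 v 0)) ->
  computable k F -> computable k (fun v => f (F v)).
Proof.
by move=> cf cF; apply: (@computable_subst k [:: F] _ cf); case.
Qed.

Lemma computable2 k f F G : computable 2 (fun v => f (nth 0 v 0) (nth 0 v 1)) ->
  computable k F -> computable k G -> computable k (fun v => f (F v) (G v)).
Proof.
by move=> cf cF cG; apply: (@computable_subst k [:: F; G] _ cf); case=> [|[|]].
Qed.

Lemma computable4 k f F G H I :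
  computable 4 (fun v => f (nth 0 v 0) (nth 0 v 1) (nth 0 v 2) (nth 0 v 3)) ->
  computable k F -> computable k G -> computable k H -> computable k I ->
  computable k (fun v => f (F v) (G v) (H v) (I v)).
Proof.
by move=> cf *; apply: (@computable_subst k [:: F; G; H; I] _ cf); case=> [|[|[|[|]]]].
Qed.

Lemma computable5 k f F G H I J :
  computable 5 (fun v => f (nth 0 v 0) (nth 0 v 1) (nth 0 v 2) (nth 0 v 3) (nth 0 v 4)) ->
  computable k F -> computable k G -> computable k H -> computable k I -> computable k J ->
  computable k (fun v => f (F v) (G v) (H v) (I v) (J v)).
Proof.
by move=> cf *; apply: (@computable_subst k [:: F; G; H; I; J] _ cf); case=> [|[|[|[|[|]]]]].
Qed.

Lemma computable_zero k : computable k (fun=> 0).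
Proof. by exists (Zero k). Qed.

Lemma computable_succ k F : computable k F -> computable k (fun v => (F v).+1).
Proof.
apply: (@computable1 _ succn); exists Succ => v /=.
by rewrite /thead (tnth_nth 0).
Qed.

Lemma computable_nat k n : computable k (fun=> n).
Proof. by elim: n => [|n IHn]; [exact: computable_zero|exact: computable_succ]. Qed.

Lemma computable_primrec k X G : computable k X -> computable k.+2 G ->
  computable k.+1 (fun v => iteri (nth 0 v 0) (fun i z => G [:: i, z & behead v]) (X (behead v))).
Proof.
move=> [p pX] [q qG]; exists (PrimRec p q) => v /=.
rewrite (_ : thead v = nth 0 v 0); last by rewrite /thead (tnth_nth 0).
elim: (nth 0 v 0) => [|n IHn] /=; first exact: (pX [tuple of behead v]).
eexists; first exact: IHn.
exact: (qG [tuple of [:: n, _ & [tuple of behead v]]]).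
Qed.

Lemma computable_iteri k T X (G : nat -> nat -> seq nat -> nat) :
  computable k T -> computable k X ->
  computable k.+2 (fun u => G (nth 0 u 0) (nth 0 u 1) (drop 2 u)) ->
  computable k (fun v => iteri (T v) (fun i z => G i z v) (X v)).
Proof.
move=> cT cX cG; have cR := computable_primrec cX cG.
pose vars := [seq (fun v => nth 0 v i) | i <- iota 0 k].
have szv : size (T :: vars) = k.+1 by rewrite /= size_map size_iota.
rewrite -szv in cR; have {cR} := computable_subst (k := k) cR.
case.
  case=> [|i] //= ik.
  rewrite size_map size_iota ltnS in ik.
  rewrite /vars (nth_map 0) ?size_iota // nth_iota //.
  exact: (@computable_var i).
move=> p pE; exists p => v.
have := pE v; congr eval; rewrite /=.
have -> : [seq G0 (val v) | G0 : seq nat -> nat <- vars] = v.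
  rewrite /vars -map_comp -[RHS](mkseq_nth 0) size_tuple; exact: eq_map.
by rewrite drop0.
Qed.

Ltac var := solve [
    apply: (@computable_var 0) => // ? ; rewrite ?nth_drop //
  | apply: (@computable_var 1) => // ? ; rewrite ?nth_drop //
  | apply: (@computable_var 2) => // ? ; rewrite ?nth_drop //
  | apply: (@computable_var 3) => // ? ; rewrite ?nth_drop //
  | apply: (@computable_var 4) => // ? ; rewrite ?nth_drop //
  | apply: (@computable_var 5) => // ? ; rewrite ?nth_drop //
  | apply: (@computable_var 6) => // ? ; rewrite ?nth_drop //
  | apply: (@computable_var 7) => // ? ; rewrite ?nth_drop //
  | apply: (@computable_var 8) => // ? ; rewrite ?nth_drop //
  | apply: (@computable_var 9) => // ? ; rewrite ?nth_drop // ].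

Lemma computable_add k F G : computable k F -> computable k G ->
  computable k (fun v => F v + G v).
Proof.
apply: computable2; apply: (@computable_ext _
  (fun v => iteri (nth 0 v 1) (fun _ z => z.+1) (nth 0 v 0))).
  by move=> v _; elim: (nth 0 v 1) => [|n /= ->]; rewrite ?addn0 ?addnS.
by apply: computable_iteri; [var|var|apply: computable_succ; var].
Qed.

Lemma computable_pred k F : computable k F -> computable k (fun v => (F v).-1).
Proof.
apply: computable1; apply: (@computable_ext _
  (fun v => iteri (nth 0 v 0) (fun i _ => i) 0)).
  by move=> v _; case: (nth 0 v 0).
by apply: (@computable_iteri 1 _ _ (fun i _ _ => i)); [var|exact: computable_zero|var].
Qed.

Lemma computable_sub k F G : computable k F -> computable k G ->
  computable k (fun v => F v - G v).
Proof.
apply: computable2; apply: (@computable_ext _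
  (fun v => iteri (nth 0 v 1) (fun _ z => z.-1) (nth 0 v 0))).
  by move=> v _; elim: (nth 0 v 1) => [|n /= ->]; rewrite ?subn0 ?subnS.
by apply: computable_iteri; [var|var|apply: computable_pred; var].
Qed.

Lemma computable_mul k F G : computable k F -> computable k G ->
  computable k (fun v => F v * G v).
Proof.
apply: computable2; apply: (@computable_ext _
  (fun v => iteri (nth 0 v 1) (fun _ z => nth 0 v 0 + z) 0)).
  by move=> v _; elim: (nth 0 v 1) => [|n /= ->]; rewrite ?muln0 ?mulnS.
apply: (@computable_iteri 2 _ _ (fun _ z v => nth 0 v 0 + z)); [var|exact: computable_zero|].
by apply: computable_add; var.
Qed.

Lemma computable_exp k F G : computable k F -> computable k G ->
  computable k (fun v => F v ^ G v).
Proof.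
apply: computable2; apply: (@computable_ext _
  (fun v => iteri (nth 0 v 1) (fun _ z => nth 0 v 0 * z) 1)).
  by move=> v _; elim: (nth 0 v 1) => [|n /= ->]; rewrite ?expn0 ?expnS.
apply: (@computable_iteri 2 _ _ (fun _ z v => nth 0 v 0 * z)); [var|exact: computable_nat|].
by apply: computable_mul; var.
Qed.

(** * Bounded sums, quantifiers and arithmetic *)

Definition bsum n (f : nat -> nat) := iteri n (fun i z => z + f i) 0.
Definition ball n (P : pred nat) : bool := all P (iota 0 n).
Definition bex n (P : pred nat) : bool := has P (iota 0 n).

Lemma computable_bsum k T (f : nat -> seq nat -> nat) : computable k T ->
  computable k.+1 (fun u => f (nth 0 u 0) (drop 1 u)) ->
  computable k (fun v => bsum (T v) (fun i => f i v)).
Proof.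
move=> cT cf; apply: (@computable_iteri k T _ (fun i z v => z + f i v)) => //.
  exact: computable_zero.
apply: computable_add; first var.
(* The body of the iteration sees the index, the accumulator, then the environment; these
   projections skip the accumulator. *)
pose vars := (fun v => nth 0 v 0) :: [seq (fun v => nth 0 v i) | i <- iota 2 k].
have szv : size vars = k.+1 by rewrite /= size_map size_iota.
rewrite -szv in cf; apply: computable_ext (computable_subst (k := k.+2) cf _).
  move=> v sv; rewrite /= drop0; congr (f _ _).
  rewrite -map_comp -[RHS](mkseq_nth 0) size_drop sv subn2 /= /mkseq -[2]addn0 iotaDl -map_comp.
  by apply: eq_map => i /=; rewrite nth_drop.
case=> [|i] ik; rewrite /vars /=; first var.
rewrite szv ltnS in ik.
rewrite (nth_map 0) ?size_iota // nth_iota //.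
by apply: (@computable_var (2 + i)) => //; lia.
Qed.

Lemma computable_neg k (P : seq nat -> bool) : computable k P ->
  computable k (fun v => ~~ P v).
Proof.
move=> cP; apply: (@computable_ext _ (fun v => 1 - P v)) => [v _|]; first by case: (P v).
by apply: computable_sub => //; exact: computable_nat.
Qed.

Lemma computable_and k (P Q : seq nat -> bool) : computable k P -> computable k Q ->
  computable k (fun v => P v && Q v).
Proof.
move=> cP cQ; apply: (@computable_ext _ (fun v => P v * Q v)) => [v _|].
  by rewrite mulnb.
exact: computable_mul.
Qed.

Lemma computable_imply k (P Q : seq nat -> bool) : computable k P -> computable k Q ->
  computable k (fun v => P v ==> Q v).
Proof.
move=> cP cQ; apply: (@computable_ext _ (fun v => ~~ (P v && ~~ Q v))) => [v _|].
  by case: (P v); case: (Q v).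
apply: computable_neg; apply: computable_and => //; exact: computable_neg.
Qed.

Lemma computable_leq k F G : computable k F -> computable k G ->
  computable k (fun v => F v <= G v).
Proof.
move=> cF cG; apply: (@computable_ext _ (fun v => 1 - (F v - G v))) => [v _|].
  by rewrite /leq; case: (F v - G v).
by apply: computable_sub; [exact: computable_nat|exact: computable_sub].
Qed.

Lemma computable_eq k F G : computable k F -> computable k G ->
  computable k (fun v => F v == G v).
Proof.
move=> cF cG; apply: (@computable_ext _ (fun v => (F v <= G v) && (G v <= F v))) => [v _|].
  by rewrite -eqn_leq.
by apply: computable_and; exact: computable_leq.
Qed.

Lemma ballP n (P : pred nat) : reflect (forall i, i < n -> P i) (ball n P).
Proof.
apply: (iffP allP) => h i; first by move=> ni; apply: h; rewrite mem_iota.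
by rewrite mem_iota => /andP[_]; exact: h.
Qed.

Lemma bexP n (P : pred nat) : reflect (exists2 i, i < n & P i) (bex n P).
Proof.
apply: (iffP hasP) => -[i].
  by rewrite mem_iota => /andP[_ ni]; exists i.
by move=> ni Pi; exists i => //; rewrite mem_iota.
Qed.

Lemma bsum_eq0 n f : (bsum n f == 0) = ball n (fun i => f i == 0).
Proof.
elim: n => //= n IHn; rewrite /ball -[n.+1]addn1 iotaD all_cat /= addn_eq0.
by rewrite -/(ball n _) -IHn andbT add0n.
Qed.

Lemma computable_ball k T (P : nat -> seq nat -> bool) : computable k T ->
  computable k.+1 (fun u => P (nth 0 u 0) (drop 1 u)) ->
  computable k (fun v => ball (T v) (fun i => P i v)).
Proof.
move=> cT cP.
apply: (@computable_ext _ (fun v => bsum (T v) (fun i => ~~ P i v) == 0)) => [v _|].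
  by congr nat_of_bool; rewrite bsum_eq0; apply: eq_all => i; case: (P i v).
apply: computable_eq (computable_zero _).
by apply: (@computable_bsum k T (fun i v => ~~ P i v)) => //; exact: computable_neg.
Qed.

Lemma computable_bex k T (P : nat -> seq nat -> bool) : computable k T ->
  computable k.+1 (fun u => P (nth 0 u 0) (drop 1 u)) ->
  computable k (fun v => bex (T v) (fun i => P i v)).
Proof.
move=> cT cP; apply: (@computable_ext _ (fun v => ~~ ball (T v) (fun i => ~~ P i v))) => [v _|].
  by congr nat_of_bool; rewrite -has_predC; apply: eq_has => i /=; rewrite negbK.
apply: computable_neg.
by apply: (@computable_ball k T (fun i v => ~~ P i v)) => //; exact: computable_neg.
Qed.

(** A number with a known upper bound is recovered by counting the [i] below it; division, [chead]
    and [csize] are evaluated this way. *)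
Lemma bsum_ltn n m : bsum n (fun i => i < m) = minn n m.
Proof. by elim: n => [|n /= ->]; rewrite ?min0n //; case: ltnP; lia. Qed.

(** The quotient is the number of positive multiples of the divisor up to the dividend. *)
Lemma computable_div k F G : (forall v, 0 < G v) -> computable k F -> computable k G ->
  computable k (fun v => F v %/ G v).
Proof.
move=> G0 cF cG; pose f a b := bsum a (fun i => i.+1 * b <= a).
apply: (@computable_ext _ (fun v => f (F v) (G v))) => [v _|].
  rewrite /f -[RHS](minn_idPr (leq_div (F v) (G v))) -bsum_ltn.
  by apply: eq_iteri => i z; rewrite leq_divRL.
apply: (@computable2 _ f) cF cG.
apply: (@computable_bsum 2 _ (fun i v => i.+1 * nth 0 v 1 <= nth 0 v 0)); first var.
by apply: computable_leq; [apply: computable_mul; [apply: computable_succ|]|]; var.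
Qed.

Lemma computable_odd k F : computable k F -> computable k (fun v => odd (F v)).
Proof.
apply: (@computable1 _ (fun n => odd n)); apply: (@computable_ext _
  (fun v => iteri (nth 0 v 0) (fun _ z => 1 - z) 0)).
  by move=> v _; elim: (nth 0 v 0) => //= n ->; case: (odd n).
apply: computable_iteri; [var|exact: computable_zero|].
by apply: computable_sub; [exact: computable_nat|var].
Qed.

Definition testbit x i := odd (x %/ 2 ^ i).

Lemma computable_testbit k F G : computable k F -> computable k G ->
  computable k (fun v => testbit (F v) (G v)).
Proof.
move=> cF cG; apply: computable_odd; apply: computable_div => //.
  by move=> v; rewrite expn_gt0.
by apply: computable_exp => //; exact: computable_nat.
Qed.

(** * Decoding of sequences *)

Definition chead c := bsum c (fun i => c %/ 2 ^ i.+1 * 2 ^ i.+1 == c).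
Definition cbehead c := c %/ 2 ^ (chead c).+1.
Definition cdrop n c := iteri n (fun _ => cbehead) c.
Definition cnth c n := chead (cdrop n c).
Definition csize c := bsum c (fun n => cdrop n c != 0).

Lemma computable_chead k F : computable k F -> computable k (fun v => chead (F v)).
Proof.
apply: computable1.
apply: (@computable_bsum 1 _ (fun i v => nth 0 v 0 %/ 2 ^ i.+1 * 2 ^ i.+1 == nth 0 v 0)).
  by var.
have cexp : computable 2 (fun u => 2 ^ (nth 0 u 0).+1).
  by apply: computable_exp; [exact: computable_nat|apply: computable_succ; var].
apply: computable_eq; last var.
apply: computable_mul => //; apply: computable_div => //; last var.
by move=> v; rewrite expn_gt0.
Qed.

Lemma computable_cbehead k F : computable k F -> computable k (fun v => cbehead (F v)).
Proof.
move=> cF; apply: computable_div => //; first by move=> v; rewrite expn_gt0.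
apply: computable_exp; first exact: computable_nat.
by apply: computable_succ; exact: computable_chead.
Qed.

Lemma computable_cdrop k F G : computable k G -> computable k F ->
  computable k (fun v => cdrop (G v) (F v)).
Proof.
apply: computable2; apply: computable_iteri; [var|var|].
by apply: computable_cbehead; var.
Qed.

Lemma computable_cnth k F G : computable k F -> computable k G ->
  computable k (fun v => cnth (F v) (G v)).
Proof. by move=> cF cG; apply: computable_chead; exact: computable_cdrop. Qed.

Lemma computable_csize k F : computable k F -> computable k (fun v => csize (F v)).
Proof.
apply: computable1; apply: (@computable_bsum 1 _ (fun n v => cdrop n (nth 0 v 0) != 0)).
  by var.
apply: computable_neg; apply: computable_eq (computable_zero _).
by apply: computable_cdrop; var.
Qed.

Lemma eq_bsum n f g : (forall i, f i = g i) -> bsum n f = bsum n g.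
Proof. by move=> fg; apply: eq_iteri => i z; rewrite fg. Qed.

(** The code is [2 ^ x] times an odd number, so [x] is its 2-adic valuation, which [chead] finds by
    counting the exponents [i.+1] with [2 ^ i.+1] dividing it. *)
Lemma chead_code x s : chead (CodeSeq.code (x :: s)) = x.
Proof.
rewrite /chead /=; set y := (_.*2).+1; set c := (_ * _).
have oy : odd y by rewrite /y /= odd_double.
have xc : x <= c.
  by rewrite (leq_trans (ltnW (ltn_expl x (ltnSn 1)))) // leq_pmulr.
rewrite (@eq_bsum _ _ (fun i => i < x)); first by rewrite bsum_ltn; apply/minn_idPr.
move=> i; congr nat_of_bool; rewrite -dvdn_eq /c.
have [ix|xi] := ltnP i x; first by rewrite dvdn_mulr // dvdn_exp2l.
have xi' : 2 ^ x.+1 %| 2 ^ i.+1 by rewrite dvdn_exp2l.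
apply/negbTE/negP => /(dvdn_trans xi').
by rewrite expnSr dvdn_pmul2l ?expn_gt0 // dvdn2 oy.
Qed.

Lemma cbehead_code x s : cbehead (CodeSeq.code (x :: s)) = CodeSeq.code s.
Proof.
rewrite /cbehead chead_code /= expnSr divnMA mulKn ?expn_gt0 // divn2.
by rewrite -addn1 -muln2; lia.
Qed.

Lemma cdrop_code n s : cdrop n (CodeSeq.code s) = CodeSeq.code (drop n s).
Proof.
elim: n s => [|n IHn] s; first by rewrite drop0.
rewrite /cdrop /= -/(cdrop n _) IHn -addn1 addnC -drop_drop.
case: (drop n s) => [|x t]; last by rewrite cbehead_code /= drop0.
by rewrite /cbehead div0n.
Qed.

Lemma cnth_code s n : cnth (CodeSeq.code s) n = nth 0 s n.
Proof.
rewrite /cnth cdrop_code -[in RHS](addn0 n) -nth_drop.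
by case: (drop n s) => // x t; rewrite chead_code.
Qed.

Lemma code_eq0 s : (CodeSeq.code s == 0) = (s == [::]).
Proof. by case: s => //= x s; rewrite muln_eq0 expn_eq0. Qed.

Lemma cdrop_neq0 s n : (cdrop n (CodeSeq.code s) != 0) = (n < size s).
Proof. by rewrite cdrop_code code_eq0 -size_eq0 size_drop subn_eq0 -ltnNge. Qed.

Lemma size_leq_code s : size s <= CodeSeq.code s.
Proof.
elim: s => //= x s IHs; apply: leq_trans (leq_pmull _ (expn_gt0 2 x)).
by rewrite ltnS -addnn (leq_trans IHs) ?leq_addr.
Qed.

Lemma csize_code s : csize (CodeSeq.code s) = size s.
Proof.
rewrite /csize (@eq_bsum _ _ (fun i => i < size s)) => [|i].
  by rewrite bsum_ltn; apply/minn_idPr; exact: size_leq_code.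
by rewrite cdrop_neq0.
Qed.

Lemma mem_leq_code s x : x \in s -> x <= CodeSeq.code s.
Proof. by move=> xs; apply/ltnW; move/allP: (CodeSeq.ltn_code s) => /(_ x xs). Qed.

(** * The decision procedure *)

Definition rel_of_erel (r : erel) : nrel := fun i j =>
  i = j \/ exists x y : 'I_(esize r), [/\ i = x, j = y & (x, y) \in egraph r].

Lemma rel_of_erelE r (x y : 'I_(esize r)) : rel_of_erel r x y <-> (x, y) \in egraph r.
Proof.
split=> [[/val_inj ->|[x' [y' [/val_inj -> /val_inj -> //]]]]|xy].
  by have [] := egraphP y y y.
by right; exists x, y.
Qed.

(** The clause [i = j] makes each position out of range a class of its own, so the laws hold on all
    of nat. *)
Lemma eqv_rel_of_erel r : eqv (rel_of_erel r).
Proof.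
have sym x y : (x, y) \in egraph r -> (y, x) \in egraph r.
  by move=> xy; have [xx /(_ xy)] := egraphP x y x; rewrite xx => <-.
split=> [i|i j|j i k]; first by left.
- case=> [->|[x [y [-> -> /sym xy]]]]; first by left.
  by right; exists y, x.
- case=> [-> //|[x [y [-> -> xy]]]] [<-|[y' [z [/val_inj <- -> yz]]]].
    by right; exists x, y.
  by right; exists x, z; split=> //; have [_ ->] := egraphP x y z.
Qed.

Lemma erel_of_rel n (R : nrel) : eqv R ->
  exists2 r, esize r = n & agree n R (rel_of_erel r).
Proof.
move=> eR; pose A := [set p : 'I_n * 'I_n | `[< R p.1 p.2 >]].
have AE x y : (x, y) \in A = `[< R x y >] by rewrite inE.
have AP : equivalence_rel (fun x y => (x, y) \in A).
  move=> x y z; rewrite !AE; split; first by apply/asboolP; exact: eqv_refl.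
  move=> /asboolP xy; apply/asbool_equiv_eq; split=> h.
    exact: (eqv_trans eR (eqv_sym eR xy) h).
  exact: (eqv_trans eR xy h).
exists (Erel AP) => // i j ni nj.
by rewrite (rel_of_erelE (r := Erel AP) (Ordinal ni) (Ordinal nj)) AE asboolE.
Qed.

Lemma cembeds_occurs r s :
  cembeds r s <-> occurs (esize r) (rel_of_erel r) (esize s) (rel_of_erel s).
Proof.
split=> [[f [[k fk] fE]]|[k [ks rs]]].
  (* A map from the empty relation is contiguous for every [k], even one that is too large, hence
     the choice of 0. *)
  have [r0|r0] := posnP (esize r); first by exists 0; rewrite r0; split.
  have lt (i : 'I_(esize r)) : k + i < esize s by rewrite -fk.
  exists k; split; first by have := lt (Ordinal (ltac:(lia) : (esize r).-1 < esize r)) => /=; lia.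
  move=> i j ri rj; rewrite /shift /pull.
  rewrite (rel_of_erelE (Ordinal ri) (Ordinal rj)) fE -rel_of_erelE.
  by rewrite !fk.
have lt (i : 'I_(esize r)) : k + i < esize s by have := ltn_ord i; lia.
exists (fun i => Ordinal (lt i)); split; first by exists k.
by move=> x y; rewrite -!rel_of_erelE; exact: rs.
Qed.

Definition avoids (B : seq erel) n (R : nrel) :=
  eqv R /\ forall r, List.In r B -> ~ occurs (esize r) (rel_of_erel r) n R.

Lemma avoids_local (B : seq erel) w :
  (forall r, List.In r B -> esize r <= w.+1) -> local_class w (avoids B).
Proof.
move=> Bw; split.
- by move=> n R [].
- move=> k m n R [eR aR] kmn; split; first exact: eqv_pull.
  by move=> r Br rR; apply: (aR r Br); apply: occurs_trans rR _; exists k.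
- move=> n R eR wn loc; split=> // r Br [k [kn rR]].
  (* A window of size [w.+1] starting at [k] may stick out on the right; moved left to fit, it still
     contains the occurrence. *)
  pose l := minn k (n - w.+1).
  have [|_ /(_ r Br)] := loc l; first by lia.
  apply; exists (k - l); split; first by have := Bw r Br; lia.
  by rewrite shift_shift (_ : l + (k - l) = k) //; lia.
- move=> n R S eS RS [_ aR]; split=> // r Br rS; apply: (aR r Br).
  by apply: occurs_trans rS _; exists 0; split=> //; exact: agree_sym.
Qed.

Lemma Av_avoids B s : Av (set_of_list B) s <-> avoids B (esize s) (rel_of_erel s).
Proof.
split=> [Bs|[_ aB] r Br]; last by rewrite cembeds_occurs; exact: aB.
by split; [exact: eqv_rel_of_erel|move=> r Br; rewrite -cembeds_occurs; exact: Bs].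
Qed.

(** Without a common host of [r] and [s], the members avoiding [r] and those avoiding [s] are proper
    downward closed sets that cover all. Conversely, a common host of members outside [A1] and [A2]
    lies in neither. *)
Lemma atomic_Av X : atomic (Av X) <->
  forall r s, Av X r -> Av X s -> exists t, [/\ Av X t, cembeds r t & cembeds s t].
Proof.
have refl r : cembeds r r by exists id; split=> //; exists 0.
split=> [[_ at_] r s Xr Xs|jep]; last first.
  split; first exact: Av_downclosed.
  case=> A1 [A2 [d1 d2 [s1 n1] [s2 n2] AE]].
  have [r Xr nr] : exists2 r, Av X r & ~ A1 r.
    by apply: contrapT => no; apply: n1 => r Xr; apply: contrapT => nr; apply: no; exists r.
  have [s Xs ns] : exists2 s, Av X s & ~ A2 s.
    by apply: contrapT => no; apply: n2 => s Xs; apply: contrapT => ns; apply: no; exists s.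
  have [t [Xt rt st]] := jep r s Xr Xs.
  move: Xt; rewrite AE => -[At|At]; [apply: nr; exact: d1 At rt|apply: ns; exact: d2 At st].
apply: contrapT => no; apply: at_.
pose A r : classical_sets.set erel := fun z => Av X z /\ ~ cembeds r z.
have dA z : downclosed (A z).
  move=> u v [Xv nzv] uv; split; first exact: Av_downclosed Xv uv.
  by move=> zu; apply: nzv; exact: cembeds_trans zu uv.
have sA z : Av X z -> classical_sets.proper (A z) (Av X).
  by move=> Xz; split=> [u []//|h]; have [_] := h z Xz; apply.
exists (A r), (A s); split=> //; [exact: sA|exact: sA|].
apply/funext => z; apply/propext; split=> [Xz|[[]|[]]//].
have [rz|nrz] := pselect (cembeds r z); last by left.
by right; split=> // sz; apply: no; exists z.
Qed.

Lemma atomic_joint B : atomic (Av (set_of_list B)) <->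
  forall m n R S, avoids B m R -> avoids B n S -> joint (avoids B) m R n S.
Proof.
rewrite atomic_Av; split=> [jep m n R S [eR aR] [eS aS]|jep r s].
  have occ k T r : esize r = k -> agree k T (rel_of_erel r) ->
      occurs k T (esize r) (rel_of_erel r) /\ occurs (esize r) (rel_of_erel r) k T.
    move=> <- Tr; split; exists 0; split=> //; exact: agree_sym.
  have av k T r : eqv T -> (forall u, List.In u B -> ~ occurs (esize u) (rel_of_erel u) k T) ->
      esize r = k -> agree k T (rel_of_erel r) -> Av (set_of_list B) r.
    move=> eT aT rk Tr; apply/Av_avoids; split; first exact: eqv_rel_of_erel.
    move=> u Bu ur; apply: (aT u Bu); apply: occurs_trans ur _.
    by have [] := occ k T r rk Tr.
  have [r rm Rr] := erel_of_rel m eR; have [s sn Ss] := erel_of_rel n eS.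
  have [t [/Av_avoids Bt /cembeds_occurs rt /cembeds_occurs st]] :=
    jep r s (av _ _ _ eR aR rm Rr) (av _ _ _ eS aS sn Ss).
  exists (esize t), (rel_of_erel t); split=> //.
    by apply: occurs_trans rt; have [] := occ m R r rm Rr.
  by apply: occurs_trans st; have [] := occ n S s sn Ss.
move=> /Av_avoids ar /Av_avoids as_; have [k [T [[eT aT] rT sT]]] := jep _ _ _ _ ar as_.
have [t tk Tt] := erel_of_rel k eT.
have kt : occurs k T (esize t) (rel_of_erel t) by exists 0; rewrite tk; split.
exists t; split.
- apply/Av_avoids; split; first exact: eqv_rel_of_erel.
  move=> u Bu ut; apply: (aT u Bu); apply: occurs_trans ut _.
  by exists 0; rewrite tk; split=> //; exact: agree_sym.
- by apply/cembeds_occurs; apply: occurs_trans rT kt.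
- by apply/cembeds_occurs; apply: occurs_trans sT kt.
Qed.

(* x codes a relation on at most W points, as a bit matrix with rows of length W. *)
Definition bit W x i j := testbit x (i * W + j).

Definition represents W n x (R : nrel) :=
  forall i j, i < n -> j < n -> (bit W x i j <-> R i j).

Definition eqvb W n x :=
  [&& ball n (fun i => bit W x i i),
      ball n (fun i => ball n (fun j => bit W x i j ==> bit W x j i)) &
      ball n (fun i => ball n (fun j => ball n (fun k =>
        bit W x i j && bit W x j k ==> bit W x i k)))].

Definition occursb W m x n y := bex n.+1 (fun k => (k + m <= n) &&
  ball m (fun i => ball m (fun j => bit W x i j == bit W y (k + i) (k + j) :> nat))).

Definition embedsb r W n x := bex n.+1 (fun k => (k + csize r <= n) &&
  ball (csize r) (fun i => ball (csize r) (fun j =>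
    cnth (cnth r i) j == bit W x (k + i) (k + j)))).

(** A list is no longer than its code, so [b < c] covers all indices. Past the end, decoding yields
    0, the code of the empty relation, which embeds everywhere; the test [cdrop b c != 0] excludes
    this. *)
Definition avoidsb c W n x := eqvb W n x &&
  ball c (fun b => (cdrop b c != 0) ==> ~~ embedsb (cnth c b) W n x).

Lemma testbit_surj L (f : pred nat) :
  exists2 x, x < 2 ^ L & forall i, i < L -> testbit x i = f i.
Proof.
elim: L f => [|L IHL] f; first by exists 0.
have [x xL xf] := IHL (fun i => f i.+1).
exists (f 0 + x * 2); first by rewrite expnS; case: (f 0); lia.
case=> [_|i iL]; rewrite /testbit.
  by rewrite expn0 divn1 oddD oddM andbF addbF oddb.
rewrite -xf // /testbit expnS divnMA (_ : (f 0 + x * 2) %/ 2 = x) //.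
by case: (f 0); lia.
Qed.

Lemma represents_exists W n R : n <= W -> exists2 x, x < 2 ^ (W * W) & represents W n x R.
Proof.
move=> nW; have [x xW xR] := testbit_surj (W * W) (fun p => `[< R (p %/ W) (p %% W) >]).
exists x => // i j ni nj; rewrite /bit xR; last by nia.
by rewrite divnMDl ?modnMDl ?divn_small ?modn_small ?addn0 ?asboolE //; lia.
Qed.

Lemma eqvb_represents W n x : eqvb W n x -> exists2 R, eqv R & represents W n x R.
Proof.
case/and3P => /ballP refl /ballP sym /ballP trans.
have {}sym i j : i < n -> j < n -> bit W x i j -> bit W x j i.
  by move=> ni nj; have /ballP/(_ j nj)/implyP := sym i ni.
have {}trans i j k : i < n -> j < n -> k < n -> bit W x i j -> bit W x j k -> bit W x i k.
  move=> ni nj nk xij xjk; have /ballP/(_ j nj)/ballP/(_ k nk)/implyP := trans i ni.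
  by rewrite xij xjk; apply.
exists (fun i j => i = j \/ [/\ i < n, j < n & bit W x i j]).
  split=> [i|i j|j i k]; first by left.
    by case=> [->|[ni nj /sym xji]]; [left|right; split=> //; exact: xji].
  case=> [-> //|[ni nj xij]] [<-|[_ nk xjk]]; right; split=> //.
  exact: trans xij xjk.
move=> i j ni nj; split=> [xij|[->|[]//]]; first by right.
exact: refl.
Qed.

Lemma eqvb_eqv W n x R : eqv R -> represents W n x R -> eqvb W n x.
Proof.
move=> eR xR; apply/and3P; split; apply/ballP => i ni.
- by apply/xR => //; exact: eqv_refl.
- by apply/ballP => j nj; apply/implyP; rewrite !xR //; exact: eqv_sym.
- apply/ballP => j nj; apply/ballP => k nk; apply/implyP => /andP[].
  rewrite !xR //; exact: eqv_trans.
Qed.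

Lemma eq_bitP (a b : bool) : reflect (a <-> b) (a == b :> nat).
Proof. by case: a; case: b; constructor; intuition. Qed.

Lemma occursbP W m x R n y S : represents W m x R -> represents W n y S ->
  (occursb W m x n y <-> occurs m R n S).
Proof.
move=> xR yS; split=> [/bexP[k _ /andP[kn /ballP xy]]|[k [kn RS]]].
  exists k; split=> // i j im jm.
  rewrite /shift /pull -xR // -yS; [|lia|lia].
  by have /ballP/(_ j jm)/eq_bitP := xy i im.
apply/bexP; exists k; first by lia.
rewrite kn /=; apply/ballP => i im; apply/ballP => j jm; apply/eq_bitP.
rewrite xR // yS; [|lia|lia]; exact: RS.
Qed.

Lemma csize_encode r : csize (encode_erel r) = esize r.
Proof. by rewrite csize_code size_map size_enum_ord. Qed.

Lemma cnth_encode r (x y : 'I_(esize r)) :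
  cnth (cnth (encode_erel r) x) y = ((x, y) \in egraph r).
Proof.
rewrite cnth_code (nth_map x) ?size_enum_ord // cnth_code (nth_map x) ?size_enum_ord //.
by rewrite !nth_ord_enum.
Qed.

Lemma embedsbP r W n x R : represents W n x R ->
  (embedsb (encode_erel r) W n x <-> occurs (esize r) (rel_of_erel r) n R).
Proof.
move=> xR; rewrite /embedsb csize_encode.
split=> [/bexP[k _ /andP[kn /ballP rx]]|[k [kn rR]]].
  exists k; split=> // i j ir jr.
  rewrite /shift /pull -xR; [|lia|lia].
  rewrite (rel_of_erelE (Ordinal ir) (Ordinal jr)).
  have /ballP/(_ j jr) := rx i ir.
  by rewrite (cnth_encode (Ordinal ir) (Ordinal jr)) => /eq_bitP.
apply/bexP; exists k; first by lia.
rewrite kn /=; apply/ballP => i ir; apply/ballP => j jr.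
rewrite (cnth_encode (Ordinal ir) (Ordinal jr)); apply/eq_bitP.
rewrite xR; [|lia|lia]; rewrite -rel_of_erelE; exact: rR.
Qed.

Lemma In_nth (B : seq erel) r : List.In r B -> exists2 b, b < size B &
  forall y, nth y [seq encode_erel s | s <- B] b = encode_erel r.
Proof.
elim: B => //= s B IHB [->|/IHB[b bB bE]]; first by exists 0.
by exists b.+1.
Qed.

Lemma nth_In (B : seq erel) b : b < size B -> exists2 r, List.In r B &
  forall y, nth y [seq encode_erel s | s <- B] b = encode_erel r.
Proof.
elim: B b => //= s B IHB [|b] bB; first by exists s => //; left.
by have [r Br rE] := IHB b bB; exists r => //; right.
Qed.

Lemma avoidsbP B W n x R : eqv R -> represents W n x R ->
  (avoidsb (encode_erels B) W n x <-> avoids B n R).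
Proof.
move=> eR xR; rewrite /avoidsb (eqvb_eqv eR xR) /=.
split=> [/ballP aB|[_ aB]].
  split=> // r /In_nth[b bB bE]; rewrite -(embedsbP _ xR).
  have bc : b < encode_erels B.
    by apply: leq_trans bB _; rewrite -(size_map encode_erel) size_leq_code.
  have := aB b bc; rewrite cdrop_neq0 size_map bB /= cnth_code bE.
  by move/negP.
apply/ballP => b _; rewrite cdrop_neq0 size_map; apply/implyP => /nth_In[r Br rE].
by rewrite cnth_code rE; apply/negP; rewrite (embedsbP _ xR); exact: aB.
Qed.

Lemma esize_leq_encode (B : seq erel) r : List.In r B -> esize r <= encode_erels B.
Proof.
move=> Br; have rE : esize r <= encode_erel r.
  by rewrite -csize_encode csize_code size_leq_code.
apply: leq_trans rE _; apply: mem_leq_code.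
have [b bB bE] := In_nth Br; rewrite -(bE 0); apply: mem_nth.
by rewrite size_map.
Qed.

(* The code [c] of the basis bounds the size of its members, so it serves as window size. *)
Definition pair_bound c := core_bound c.
Definition host_bound c := joint_bound c (pair_bound c) (pair_bound c).
Definition code_bound c := 2 ^ (host_bound c * host_bound c).

(** The matrices of the pair and of the host all have row length [host_bound c], so [code_bound c]
    is the search bound for each. *)
Definition jointb c m x n y := bex (host_bound c).+1 (fun t => bex (code_bound c) (fun z =>
  [&& avoidsb c (host_bound c) t z, occursb (host_bound c) m x t z &
      occursb (host_bound c) n y t z])).

Definition atomicb c :=
  ball (pair_bound c).+1 (fun m => ball (code_bound c) (fun x =>
  ball (pair_bound c).+1 (fun n => ball (code_bound c) (fun y =>
    avoidsb c (host_bound c) m x && avoidsb c (host_bound c) n y ==> jointb c m x n y)))).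

Lemma avoidsb_represents B W n x : avoidsb (encode_erels B) W n x ->
  exists2 R, avoids B n R & represents W n x R.
Proof.
move=> a; have /andP[/eqvb_represents[R eR xR] _] := a.
by exists R => //; apply/(avoidsbP B eR xR).
Qed.

(** From left to right, [small_joint] passes from the tested pairs to all pairs; from right to left,
    [joint_bounded] yields a host within the range of the search. *)
Lemma atomicbP B : atomicb (encode_erels B) <-> atomic (Av (set_of_list B)).
Proof.
rewrite atomic_joint; set c := encode_erels B.
have CP : local_class c (avoids B).
  by apply: avoids_local => r /esize_leq_encode; exact: leqW.
have pairs_hosts : pair_bound c <= host_bound c by rewrite /host_bound /joint_bound; lia.
split=> [/ballP dec m n R S|jep].
  apply: (small_joint CP (leqnn (core_bound c))) => {}m {}n {}R {}S mc nc aR aS.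
  have [eR _] := aR; have [eS _] := aS.
  have [x xc xR] := represents_exists R (leq_trans mc pairs_hosts).
  have [y yc yS] := represents_exists S (leq_trans nc pairs_hosts).
  have /ballP/(_ x xc)/ballP/(_ n nc)/ballP/(_ y yc)/implyP jointRS := dec m mc.
  have /jointRS : avoidsb c (host_bound c) m x && avoidsb c (host_bound c) n y.
    by apply/andP; split; [apply/(avoidsbP B eR xR)|apply/(avoidsbP B eS yS)].
  move=> /bexP[t _ /bexP[z _ /and3P[/avoidsb_represents[T aT zT] xz yz]]].
  by exists t, T; split=> //; [apply/(occursbP xR zT)|apply/(occursbP yS zT)].
apply/ballP => m mc; apply/ballP => x _; apply/ballP => n nc; apply/ballP => y _.
apply/implyP => /andP[/avoidsb_represents[R aR xR] /avoidsb_represents[S aS yS]].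
have [t [T [tb aT RT ST]]] := joint_bounded CP (jep _ _ _ _ aR aS).
have tc : t <= host_bound c by apply: leq_trans tb _; rewrite /host_bound /joint_bound; lia.
have [z zc zT] := represents_exists T tc; have [eT _] := aT.
apply/bexP; exists t => //; apply/bexP; exists z => //.
apply/and3P; split; first by apply/(avoidsbP B eT zT).
- by apply/(occursbP xR zT).
- by apply/(occursbP yS zT).
Qed.

(** * Computability of the procedure *)

Lemma computable_bit k F G H I : computable k F -> computable k G -> computable k H ->
  computable k I -> computable k (fun v => bit (F v) (G v) (H v) (I v)).
Proof.
move=> cF cG cH cI; apply: computable_testbit => //.
by apply: computable_add => //; exact: computable_mul.
Qed.

Ltac comp := repeat first [var | apply: computable_ball | apply: computable_bex
  | apply: computable_nat | apply: computable_and | apply: computable_imply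
  | apply: computable_neg
  | apply: computable_leq | apply: computable_eq | apply: computable_bit
  | apply: computable_succ | apply: computable_add | apply: computable_mul
  | apply: computable_exp | apply: computable_cnth | apply: computable_cdrop
  | apply: computable_csize].

Lemma computable_eqvb k F G H : computable k F -> computable k G -> computable k H ->
  computable k (fun v => eqvb (F v) (G v) (H v)).
Proof.
move=> cF cG cH; apply: (@computable4 k (fun a b c _ => eqvb a b c) F G H H) => //.
rewrite /eqvb; comp.
Qed.

Lemma computable_occursb k F G H I J : computable k F -> computable k G ->
  computable k H -> computable k I -> computable k J ->
  computable k (fun v => occursb (F v) (G v) (H v) (I v) (J v)).
Proof. apply: (@computable5 k occursb); rewrite /occursb; comp. Qed.

Lemma computable_embedsb k F G H I : computable k F -> computable k G ->
  computable k H -> computable k I ->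
  computable k (fun v => embedsb (F v) (G v) (H v) (I v)).
Proof. apply: (@computable4 k embedsb); rewrite /embedsb; comp. Qed.

Lemma computable_avoidsb k F G H I : computable k F -> computable k G ->
  computable k H -> computable k I ->
  computable k (fun v => avoidsb (F v) (G v) (H v) (I v)).
Proof.
apply: (@computable4 k avoidsb); rewrite /avoidsb.
by repeat first [apply: computable_ball | apply: computable_bex
  | apply: computable_embedsb | apply: computable_eqvb | progress comp].
Qed.

Lemma computable_host_bound k F : computable k F ->
  computable k (fun v => host_bound (F v)).
Proof.
apply: computable1.
rewrite /host_bound /joint_bound /pair_bound /core_bound /margin /nwindows; comp.
Qed.

Lemma computable_pair_bound k F : computable k F ->
  computable k (fun v => pair_bound (F v)).
Proof. by apply: computable1; rewrite /pair_bound /core_bound /margin /nwindows; comp. Qed.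

Lemma computable_code_bound k F : computable k F ->
  computable k (fun v => code_bound (F v)).
Proof.
move=> cF; apply: computable_exp; first exact: computable_nat.
by apply: computable_mul; exact: computable_host_bound.
Qed.

Lemma computable_jointb k F G H I J : computable k F -> computable k G ->
  computable k H -> computable k I -> computable k J ->
  computable k (fun v => jointb (F v) (G v) (H v) (I v) (J v)).
Proof.
apply: (@computable5 k jointb); rewrite /jointb.
apply: computable_bex; first by apply: computable_succ; apply: computable_host_bound; var.
apply: computable_bex; first by apply: computable_code_bound; var.
apply: computable_and.
  by apply: computable_avoidsb; [var|apply: computable_host_bound; var|var|var].
by apply: computable_and; apply: computable_occursb;
  [apply: computable_host_bound; var|var|var|var|var
  |apply: computable_host_bound; var|var|var|var|var].
Qed.

Lemma computable_atomicb k F : computable k F -> computable k (fun v => atomicb (F v)).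
Proof.
apply: (@computable1 k atomicb); rewrite /atomicb.
apply: computable_ball; first by apply: computable_succ; apply: computable_pair_bound; var.
apply: computable_ball; first by apply: computable_code_bound; var.
apply: computable_ball; first by apply: computable_succ; apply: computable_pair_bound; var.
apply: computable_ball; first by apply: computable_code_bound; var.
apply: computable_imply; last by apply: computable_jointb; var.
by apply: computable_and; apply: computable_avoidsb;
  [var|apply: computable_host_bound; var|var|var
  |var|apply: computable_host_bound; var|var|var].
Qed.

Theorem theorem10p8 :
  recursively_decidable encode_erels
    (fun B : seq erel => atomic (Av (set_of_list B))).
Proof.
have [|p pE] := @computable_atomicb 1 (fun v => nth 0 v 0); first var.
exists p => B; have /= pB := pE [tuple encode_erels B].
split=> [/atomicbP aB|naB]; first by rewrite aB in pB.
suff naB' : atomicb (encode_erels B) = false by rewrite naB' in pB.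
by apply/negbTE/negP => /atomicbP.
Qed.
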